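(* Let $\widehat{\mathbf{u}}(\cdot)$ be a feedback policy of one of the following four forms, for an arbitrary fixed value of the neural network parameters $\boldsymbol{\theta}\in\mathbb{R}^p$. (i) ($\lambda_{\mathrm{Jac}}$-QRnet) $\widehat{\mathbf{u}}(\mathbf{x})=\mathbf{u}^*(\mathbf{x};\widehat{\boldsymbol{\lambda}}(\mathbf{x}))$ with $$\widehat{\boldsymbol{\lambda}}(\mathbf{x})=\left[2\mathbf{P}-\frac{\partial\mathcal{N}}{\partial\mathbf{x}}(\mathbf{x}_f;\boldsymbol{\theta})\right](\mathbf{x}-\mathbf{x}_f)+\mathcal{N}(\mathbf{x};\boldsymbol{\theta})-\mathcal{N}(\mathbf{x}_f;\boldsymbol{\theta}),\qquad \mathcal{N}:\mathbb{R}^n\times\mathbb{R}^p\to\mathbb{R}^n.$$ (ii) ($\lambda_{\mathrm{mat}}$-QRnet) $\widehat{\mathbf{u}}(\mathbf{x})=\mathbf{u}^*(\mathbf{x};\widehat{\boldsymbol{\lambda}}(\mathbf{x}))$ with $$\widehat{\boldsymbol{\lambda}}(\mathbf{x})=\left[2\mathbf{P}+\mathcal{N}(\mathbf{x};\boldsymbol{\theta})-\mathcal{N}(\mathbf{x}_f;\boldsymbol{\theta})\right](\mathbf{x}-\mathbf{x}_f),\qquad \mathcal{N}:\mathbb{R}^n\times\mathbb{R}^p\to\mathbb{R}^{n\times n}.$$ (iii) ($u_{\mathrm{Jac}}$-QRnet) $$\widehat{\mathbf{u}}(\mathbf{x})=\sigma\left[\mathrm{sat}\left(\mathbf{u}^{\mathrm{LQR}}(\mathbf{x})\right)-\left[\frac{\partial\mathcal{N}}{\partial\mathbf{x}}(\mathbf{x}_f;\boldsymbol{\theta})\right](\mathbf{x}-\mathbf{x}_f)+\mathcal{N}(\mathbf{x};\boldsymbol{\theta})-\mathcal{N}(\mathbf{x}_f;\boldsymbol{\theta})\right],\qquad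 \mathcal{N}:\mathbb{R}^n\times\mathbb{R}^p\to\mathbb{R}^m.$$ (iv) ($u_{\mathrm{mat}}$-QRnet) $$\widehat{\mathbf{u}}(\mathbf{x})=\sigma\left[\mathrm{sat}\left(\mathbf{u}^{\mathrm{LQR}}(\mathbf{x})\right)+\left[\mathcal{N}(\mathbf{x};\boldsymbol{\theta})-\mathcal{N}(\mathbf{x}_f;\boldsymbol{\theta})\right](\mathbf{x}-\mathbf{x}_f)\right],\qquad \mathcal{N}:\mathbb{R}^n\times\mathbb{R}^p\to\mathbb{R}^{m\times n}.$$ Then $\frac{\partial\widehat{\mathbf{u}}}{\partial\mathbf{x}}(\mathbf{x}_f)=-\mathbf{K}$, and $\mathbf{x}_f$ is a locally asymptotically stable equilibrium of the closed loop system $\dot{\mathbf{x}}=\mathbf{f}(\mathbf{x},\widehat{\mathbf{u}}(\mathbf{x}))$.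
   Context: Setting. The control set is the box $\mathbb{U}=\{\mathbf{u}\in\mathbb{R}^m: u_{\min,i}\le u_i\le u_{\max,i},\ i=1,\dots,m\}$ for vectors $\mathbf{u}_{\min},\mathbf{u}_{\max}\in\mathbb{R}^m$. The vector field $\mathbf{f}:\mathbb{R}^n\times\mathbb{U}\to\mathbb{R}^n$ is continuously differentiable in $\mathbf{x}$ and $\mathbf{u}$, and $(\mathbf{x}_f,\mathbf{u}_f)\in\mathbb{R}^n\times\mathbb{U}$ satisfies $\mathbf{f}(\mathbf{x}_f,\mathbf{u}_f)=\mathbf{0}$, with $\mathbf{u}_f$ an interior point of $\mathbb{U}$. The running cost of the infinite horizon optimal control problem (minimize $\int_0^\infty\mathcal{L}(\mathbf{x},\mathbf{u})\,dt$ subject to $\dot{\mathbf{x}}=\mathbf{f}(\mathbf{x},\mathbf{u})$, $\mathbf{x}(0)=\mathbf{x}_0$, $\mathbf{u}(t)\in\mathbb{U}$) is $\mathcal{L}(\mathbf{x},\mathbf{u})=q(\mathbf{x})+r(\mathbf{u})$, with $q:\mathbb{R}^n\to[0,\infty)$ and $r:\mathbb{U}\to[0,\infty)$ smooth, $q(\mathbf{x}_f)=0$, $r(\mathbf{u}_f)=0$, $q(\mathbf{x})\ge0$ for $\mathbf{x}\ne\mathbf{x}_f$, and $r(\mathbf{u})>0$ for $\mathbf{u}\neq\mathbf{u}_f$. The problem is assumed well-posed, i.e. an optimal control with finite cost exists. Hamiltonian minimizer. For $\boldsymbol{\lambda}\in\mathbb{R}^n$ let $\mathcal{H}(\mathbf{x},\boldsymbol{\lambda},\mathbf{u})=\mathcal{L}(\mathbf{x},\mathbf{u})+\boldsymbol{\lambda}^T\mathbf{f}(\mathbf{x},\mathbf{u})$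 and $\mathbf{u}^*(\mathbf{x};\boldsymbol{\lambda})=\arg\min_{\mathbf{u}\in\mathbb{U}}\mathcal{H}(\mathbf{x},\boldsymbol{\lambda},\mathbf{u})$, understood as a (single-valued) function of $(\mathbf{x},\boldsymbol{\lambda})$. LQR. Let $$\mathbf{A}=\frac{\partial\mathbf{f}}{\partial\mathbf{x}}(\mathbf{x}_f,\mathbf{u}_f),\quad \mathbf{B}=\frac{\partial\mathbf{f}}{\partial\mathbf{u}}(\mathbf{x}_f,\mathbf{u}_f),\quad \mathbf{Q}=\frac12\frac{\partial^2q}{\partial\mathbf{x}^2}(\mathbf{x}_f),\quad \mathbf{R}=\frac12\frac{\partial^2r}{\partial\mathbf{u}^2}(\mathbf{u}_f),$$ where $\mathbf{R}$ is positive definite, $(\mathbf{A},\mathbf{B})$ is controllable and $(\mathbf{A},\mathbf{Q}^{1/2})$ is observable. Let $\mathbf{P}\in\mathbb{R}^{n\times n}$ be the symmetric positive definite solution of the Riccati equation $\mathbf{Q}+\mathbf{A}^T\mathbf{P}+\mathbf{P}\mathbf{A}-\mathbf{P}\mathbf{B}\mathbf{R}^{-1}\mathbf{B}^T\mathbf{P}=\mathbf{0}$, and set $\mathbf{K}=\mathbf{R}^{-1}\mathbf{B}^T\mathbf{P}$ and $\mathbf{u}^{\mathrm{LQR}}(\mathbf{x})=\mathbf{u}_f-\mathbf{K}(\mathbf{x}-\mathbf{x}_f)$. Saturation functions. $[\mathrm{sat}(\mathbf{u})]_i$ equals $u_{\min,i}$ if $u_i<u_{\min,i}$, $u_i$ if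 $u_{\min,i}\le u_i\le u_{\max,i}$, and $u_{\max,i}$ if $u_i>u_{\max,i}$. The smooth saturation $\sigma:\mathbb{R}^m\to\mathbb{U}$ is $$\sigma(\mathbf{u})=\mathbf{u}_{\min}+\frac{\mathbf{u}_{\max}-\mathbf{u}_{\min}}{1+\mathbf{c}_1\exp[-\mathbf{c}_2(\mathbf{u}-\mathbf{u}_f)]},\quad \mathbf{c}_1=\frac{\mathbf{u}_{\max}-\mathbf{u}_f}{\mathbf{u}_f-\mathbf{u}_{\min}},\quad \mathbf{c}_2=\frac{\mathbf{u}_{\max}-\mathbf{u}_{\min}}{(\mathbf{u}_{\max}-\mathbf{u}_f)(\mathbf{u}_f-\mathbf{u}_{\min})},$$ with all operations (multiplication, division, exponential) performed element-wise. Neural networks. In each case $\mathcal{N}(\cdot;\boldsymbol{\theta})$ is a feedforward neural network (a finite composition of affine maps and componentwise activation functions, whose output is reshaped into a matrix where needed) with continuously differentiable activation functions and parameters $\boldsymbol{\theta}$; in particular it is continuously differentiable in $\mathbf{x}$. *)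

(* Defs.v *)
From HB Require Import structures.
From mathcomp Require Import all_boot all_order all_algebra.
From mathcomp Require Import all_classical all_reals all_analysis.

Set Implicit Arguments.
Unset Strict Implicit.
Unset Printing Implicit Defensive.

Import Order.TTheory GRing.Theory Num.Theory.
Import numFieldNormedType.Exports.

Local Open Scope classical_set_scope.
Local Open Scope ring_scope.

(* Vectors are columns.  The library's ['J F a] acts on row vectors and is thus
   the transpose of the usual matrix of partial derivatives. *)
Definition Jac (R : realType) (n k : nat) (F : 'cV[R]_n -> 'cV[R]_k)
    (a : 'cV[R]_n) : 'M[R]_(k, n) :=
  \matrix_(i, j) ('D_(delta_mx j 0) F a) i 0.

Definition Hess (R : realType) (n : nat) (g : 'cV[R]_n -> R)
    (a : 'cV[R]_n) : 'M[R]_n :=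
  \matrix_(i, j) 'D_(delta_mx i 0) (fun z => 'D_(delta_mx j 0) g z) a.

(* Differentiability relative to a set that need not be open: only the values
   of [g] on [D] are involved, and [dg] need only be its gradient on [D]. *)
Definition has_gradient_on (R : realType) (k : nat) (D : set 'cV[R]_k)
    (g : 'cV[R]_k -> R) (dg : 'I_k -> 'cV[R]_k -> R) : Prop :=
  forall a, D a ->
    (g z - g a - \sum_(i < k) dg i a * (z i 0 - a i 0)) / `|z - a|
      @[z --> within D a^'] --> (0 : R).

Fixpoint Ck_on (R : realType) (k : nat) (D : set 'cV[R]_k) (p : nat)
    (g : 'cV[R]_k -> R) : Prop :=
  if p is p'.+1 then
    exists2 dg : 'I_k -> 'cV[R]_k -> R,
      has_gradient_on D g dg & forall i, Ck_on D p' (dg i)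
  else {within D, continuous g}.

Definition smooth_on (R : realType) (k : nat) (D : set 'cV[R]_k)
    (g : 'cV[R]_k -> R) : Prop :=
  forall p, Ck_on D p g.

(* Joint C^1 regularity on R^n x U, with (x, u) stacked into one column. *)
Definition C1_field (R : realType) (n m : nat) (U : set 'cV[R]_m)
    (f : 'cV[R]_n -> 'cV[R]_m -> 'cV[R]_n) : Prop :=
  forall i, Ck_on [set z : 'cV[R]_(n + m) | U (dsubmx z)] 1
    (fun z => f (usubmx z) (dsubmx z) i 0).

Definition box (R : realType) (m : nat) (umin umax : 'cV[R]_m)
    : set 'cV[R]_m :=
  [set u | forall i, umin i 0 <= u i 0 <= umax i 0].

Definition argmin (R : realType) (T : Type) (D : set T) (g : T -> R) : set T :=
  [set u | D u /\ forall v, D v -> g u <= g v].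

Definition hamiltonian (R : realType) (n m : nat) (q : 'cV[R]_n -> R)
    (r : 'cV[R]_m -> R) (f : 'cV[R]_n -> 'cV[R]_m -> 'cV[R]_n)
    (x lam : 'cV[R]_n) (u : 'cV[R]_m) : R :=
  q x + r u + (lam^T *m f x u) 0 0.

(* [x] is locally absolutely continuous and solves the state equation for almost
   every time, which is stated in integrated form. *)
Definition admissible (R : realType) (n m : nat) (U : set 'cV[R]_m)
    (f : 'cV[R]_n -> 'cV[R]_m -> 'cV[R]_n) (x0 : 'cV[R]_n)
    (x : R -> 'cV[R]_n) (u : R -> 'cV[R]_m) : Prop :=
  [/\ forall t, 0 <= t -> U (u t),
      forall i, measurable_fun (`[0, +oo[%classic : set R)
                  (fun t : R => u t i 0) &
      forall t, 0 <= t -> forall i,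
        lebesgue_measure.-integrable (`[0, t]%classic : set R)
          (fun s => (f (x s) (u s) i 0)%:E) /\
        x t i 0 = x0 i 0
          + Rintegral lebesgue_measure (`[0, t]%classic : set R)
              (fun s => f (x s) (u s) i 0)].

Definition cost (R : realType) (n m : nat) (q : 'cV[R]_n -> R)
    (r : 'cV[R]_m -> R) (x : R -> 'cV[R]_n) (u : R -> 'cV[R]_m) : \bar R :=
  (\int[lebesgue_measure]_(t in `[0%R, +oo[) (q (x t) + r (u t))%:E)%E.

Definition well_posed (R : realType) (n m : nat) (U : set 'cV[R]_m)
    (f : 'cV[R]_n -> 'cV[R]_m -> 'cV[R]_n) (q : 'cV[R]_n -> R)
    (r : 'cV[R]_m -> R) (x0 : 'cV[R]_n) : Prop :=
  exists x u, [/\ admissible U f x0 x u,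
    (cost q r x u < +oo)%E &
    forall x' u', admissible U f x0 x' u' ->
      (cost q r x u <= cost q r x' u')%E].

Definition posdef (R : realType) (n : nat) (M : 'M[R]_n) : Prop :=
  M^T = M /\ forall v : 'cV[R]_n, v != 0 -> 0 < (v^T *m M *m v) 0 0.

Definition possemidef (R : realType) (n : nat) (M : 'M[R]_n) : Prop :=
  M^T = M /\ forall v : 'cV[R]_n, 0 <= (v^T *m M *m v) 0 0.

Definition is_sqrtmx (R : realType) (n : nat) (M S : 'M[R]_n) : Prop :=
  possemidef S /\ S *m S = M.

Definition controllable (R : realType) (n m : nat) (A : 'M[R]_n)
    (B : 'M[R]_(n, m)) : Prop :=
  \rank (\mxrow_(k < n) (A ^+ k *m B)) = n.

Definition observable (R : realType) (n k : nat) (A : 'M[R]_n)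
    (C : 'M[R]_(k, n)) : Prop :=
  \rank (\mxcol_(j < n) (C *m A ^+ j)) = n.

Definition lqr_gain (R : realType) (n m : nat) (Rm : 'M[R]_m)
    (B : 'M[R]_(n, m)) (P : 'M[R]_n) : 'M[R]_(m, n) :=
  invmx Rm *m B^T *m P.

Definition u_lqr (R : realType) (n m : nat) (K : 'M[R]_(m, n))
    (xf : 'cV[R]_n) (uf : 'cV[R]_m) (x : 'cV[R]_n) : 'cV[R]_m :=
  uf - K *m (x - xf).

Definition sat (R : realType) (m : nat) (umin umax u : 'cV[R]_m) : 'cV[R]_m :=
  \col_i (if u i 0 < umin i 0 then umin i 0
          else if u i 0 <= umax i 0 then u i 0 else umax i 0).

Definition smooth_sat (R : realType) (m : nat) (umin umax uf u : 'cV[R]_m)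
    : 'cV[R]_m :=
  \col_i
    (let c1 := (umax i 0 - uf i 0) / (uf i 0 - umin i 0) in
     let c2 := (umax i 0 - umin i 0)
                 / ((umax i 0 - uf i 0) * (uf i 0 - umin i 0)) in
     umin i 0 + (umax i 0 - umin i 0)
                  / (1 + c1 * expR (- c2 * (u i 0 - uf i 0)))).

(* Activation functions may differ from one component to the next. *)
Inductive feedforward (R : realType) :
    forall n k : nat, ('cV[R]_n -> 'cV[R]_k) -> Prop :=
| ff_affine n k (W : 'M[R]_(k, n)) (b : 'cV[R]_k) :
    feedforward (fun x => W *m x + b)
| ff_activation n (s : 'I_n -> R -> R) :
    (forall i, (forall t, derivable (s i) t 1) /\ continuous (derive1 (s i))) ->
    feedforward (fun x : 'cV[R]_n => \col_i s i (x i 0))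
| ff_comp n h k (G : 'cV[R]_h -> 'cV[R]_k) (F : 'cV[R]_n -> 'cV[R]_h) :
    feedforward G -> feedforward F -> feedforward (G \o F).

Definition network (R : realType) (n p k : nat)
    (N : 'cV[R]_n -> 'cV[R]_p -> 'cV[R]_k) : Prop :=
  forall theta, feedforward (N ^~ theta).

Definition reshape_mx (R : realType) (k n : nat) (v : 'cV[R]_(k * n))
    : 'M[R]_(k, n) :=
  vec_mx v^T.

Definition lambda_jac (R : realType) (n : nat) (P : 'M[R]_n) (xf : 'cV[R]_n)
    (N : 'cV[R]_n -> 'cV[R]_n) (x : 'cV[R]_n) : 'cV[R]_n :=
  (2%:R *: P - Jac N xf) *m (x - xf) + N x - N xf.

Definition lambda_mat (R : realType) (n : nat) (P : 'M[R]_n) (xf : 'cV[R]_n)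
    (N : 'cV[R]_n -> 'M[R]_n) (x : 'cV[R]_n) : 'cV[R]_n :=
  (2%:R *: P + N x - N xf) *m (x - xf).

Definition u_jac (R : realType) (n m : nat) (umin umax : 'cV[R]_m)
    (K : 'M[R]_(m, n)) (xf : 'cV[R]_n) (uf : 'cV[R]_m)
    (N : 'cV[R]_n -> 'cV[R]_m) (x : 'cV[R]_n) : 'cV[R]_m :=
  smooth_sat umin umax uf
    (sat umin umax (u_lqr K xf uf x) - Jac N xf *m (x - xf) + N x - N xf).

Definition u_mat (R : realType) (n m : nat) (umin umax : 'cV[R]_m)
    (K : 'M[R]_(m, n)) (xf : 'cV[R]_n) (uf : 'cV[R]_m)
    (N : 'cV[R]_n -> 'M[R]_(m, n)) (x : 'cV[R]_n) : 'cV[R]_m :=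
  smooth_sat umin umax uf
    (sat umin umax (u_lqr K xf uf x) + (N x - N xf) *m (x - xf)).

Definition is_solution (R : realType) (n : nat) (g : 'cV[R]_n -> 'cV[R]_n)
    (T : \bar R) (x0 : 'cV[R]_n) (y : R -> 'cV[R]_n) : Prop :=
  [/\ y 0 = x0,
      {within [set t : R | 0 <= t /\ (t%:E < T)%E], continuous y} &
      forall t : R, 0 < t -> (t%:E < T)%E -> is_derive t 1 y (g (y t))].

(* The vector field need not be locally Lipschitz, so solutions need not be
   unique: global existence is required for nearby initial states, and the
   bounds are required of every solution, including those defined on a bounded
   time interval only. *)
Definition lyapunov_stable (R : realType) (n : nat)
    (g : 'cV[R]_n -> 'cV[R]_n) (xf : 'cV[R]_n) : Prop :=
  forall eps : R, 0 < eps -> exists2 delta : R, 0 < delta &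
    forall x0 : 'cV[R]_n, `|x0 - xf| < delta ->
      (exists y, is_solution g +oo%E x0 y) /\
      forall T y, is_solution g T x0 y ->
        forall t : R, 0 <= t -> (t%:E < T)%E -> `|y t - xf| < eps.

Definition locally_attractive (R : realType) (n : nat)
    (g : 'cV[R]_n -> 'cV[R]_n) (xf : 'cV[R]_n) : Prop :=
  exists2 delta : R, 0 < delta &
    forall x0 : 'cV[R]_n, `|x0 - xf| < delta ->
      forall y, is_solution g +oo%E x0 y -> y t @[t --> +oo] --> xf.

Definition loc_asymp_stable_equilibrium (R : realType) (n : nat)
    (g : 'cV[R]_n -> 'cV[R]_n) (xf : 'cV[R]_n) : Prop :=
  [/\ g xf = 0, lyapunov_stable g xf & locally_attractive g xf].

(* Main.v *)
Require Import Defs.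
From HB Require Import structures.
From mathcomp Require Import all_boot all_order all_algebra.
From mathcomp Require Import all_classical all_reals all_analysis.
From mathcomp Require Import ring lra.

Set Implicit Arguments.
Unset Strict Implicit.
Unset Printing Implicit Defensive.

Import Order.TTheory GRing.Theory Num.Theory.
Import numFieldNormedType.Exports.

Local Open Scope classical_set_scope.
Local Open Scope ring_scope.

(** Every one of the four policies [uhat] satisfies [uhat xf = uf], is continuous
    with values in the box, and expands as
    [uhat x = uf - K (x - xf) + o(x - xf)].  This is all that stability needs:
    the closed loop [g x = f x (uhat x)] is then continuous, vanishes at [xf] and
    has the LQR matrix [Acl = A - B K] as Jacobian there.

    Expansion of the saturated policies.  Near [xf] the hard saturation is the
    identity, because [uf] is interior; the smooth one fixes [uf] with derivative
    the identity; and the network correction is [o(x - xf)], because its linear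
    part is subtracted, or because it is a product of two factors vanishing at
    [xf] ([saturated_policy_has_jac]).

    Expansion of the costate policies.  Here [lam x = 2 P (x - xf) + o(x - xf)].
    A unique minimizer over a compact set depends continuously on the parameter
    ([argmin_continuous]), so [uhat x] is interior for [x] near [xf] and satisfies
    [r'(uhat x) + (df/du)^T lam x = 0].  Since [r'] has the derivative [2 R] at
    [uf] and [df/du] tends to [B], this reads
    [2 R (uhat x - uf) + 2 B^T P (x - xf) = o(|uhat x - uf| + |x - xf|)],
    which gives both the Lipschitz bound and the derivative [- R^-1 B^T P]
    ([minimizer_has_jac]).

    Stability of [Acl].  The Riccati equation says that [x^T P x] decreases along
    [x' = Acl x] at the rate [x^T S x] with [S = Q + K^T R K], a form that is only
    semidefinite.  Observability of [(A, Q^1/2)] passes to [(Acl, S)], because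
    [Acl] and [A] agree as long as [K x] vanishes ([lqr_observable]).  Small
    multiples of the forms [x^T (Acl^k)^T S Acl^(k+1) x], added from the highest
    [k] downwards, then turn [P] into a quadratic form that decreases strictly
    ([strict_lyapunov]); it plays the part of LaSalle's principle and, unlike it,
    survives the perturbation [o(x - xf)] ([lyapunov_decrease]).

    Solutions.  Since [df/du] is merely continuous, a costate policy need not be
    Lipschitz and solutions need not be unique.  They exist by Peano's theorem
    ([peano_bounded]): the Euler polygons converge pointwise along an ultrafilter,
    and the inequality that expresses differentiability passes to the limit.  The
    Lyapunov function confines every solution to a small ball and makes it decay
    exponentially ([lyapunov_trap], [lyapunov_decay]). *)

(** * Sup norm and epsilon-delta characterizations *)

Section SupNorm.
Context {R : realType}.

Lemma mx_norm_leP m n (M : 'M[R]_(m, n)) (e : R) : 0 <= e ->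
  `|M| <= e <-> forall i j, `|M i j| <= e.
Proof.
move=> e0; rewrite /Num.Def.normr /= mx_normrE; split.
  by move=> /bigmax_leP[_ h] i j; exact: (h (i, j)).
by move=> h; apply/bigmax_leP; split=> // -[i j] _; exact: h.
Qed.

Lemma ler_mx_coord m n (M : 'M[R]_(m, n)) i j : `|M i j| <= `|M|.
Proof. by move: i j; apply/mx_norm_leP. Qed.

Lemma ler_norm_mulmx m n p (A : 'M[R]_(m, n)) (B : 'M[R]_(n, p)) :
  `|A *m B| <= n%:R * `|A| * `|B|.
Proof.
apply/mx_norm_leP => [|i j]; first by rewrite !mulr_ge0.
rewrite mxE; apply: le_trans (ler_norm_sum _ _ _) _.
apply: (@le_trans _ _ (\sum_(k < n) `|A| * `|B|)).
  by apply: ler_sum => k _; rewrite normrM ler_pM // ler_mx_coord.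
by rewrite sumr_const card_ord -[_ *+ n]mulr_natl mulrA.
Qed.

Lemma norm_trmx m n (A : 'M[R]_(m, n)) : `|A^T| = `|A|.
Proof.
apply/eqP; rewrite eq_le; apply/andP; split; apply/mx_norm_leP => // i j.
  by rewrite mxE ler_mx_coord.
by rewrite -[A i j](mxE trmx_key (fun j i => A i j)) ler_mx_coord.
Qed.

Lemma norm_mx11 (A : 'M[R]_1) : `|A 0 0| = `|A|.
Proof.
apply/eqP; rewrite eq_le ler_mx_coord; apply/mx_norm_leP => // i j.
by rewrite !ord1.
Qed.

Lemma norm_delta_mx n (i : 'I_n) : `|delta_mx i 0 : 'cV[R]_n| = 1.
Proof.
apply/eqP; rewrite eq_le; apply/andP; split.
  by apply/mx_norm_leP => // k j; rewrite mxE; case: (_ && _); rewrite ?normr1 ?normr0.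
by rewrite (le_trans _ (ler_mx_coord _ i 0)) // mxE !eqxx normr1.
Qed.

Lemma norm_le_col_mx n m (a : 'cV[R]_n) (b : 'cV[R]_m) (e : R) :
  `|a| <= e -> `|b| <= e -> `|col_mx a b| <= e.
Proof.
move=> ae be; have e0 : 0 <= e by exact: le_trans ae.
apply/mx_norm_leP => // i j; rewrite mxE.
by case: splitP => k _; apply: le_trans (ler_mx_coord _ _ _) _.
Qed.

End SupNorm.

Lemma near_normP {K : realType} {V : normedModType K} (a : V) (P : V -> Prop) :
  (\forall x \near a, P x) <->
  exists2 d : K, 0 < d & forall x, `|x - a| < d -> P x.
Proof.
split=> [h0|[d d0 h]].
  have [d d0 h] := (nbhs_normP a P).1 h0.
  by exists d => // x xa; apply: h; rewrite /ball_ /= distrC.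
apply: (nbhs_normP a P).2; exists d => // x; rewrite /ball_ /= distrC; exact: h.
Qed.

Lemma cvg_normP {K : realType} {V W : normedModType K} (F : V -> W) (a : V) (l : W) :
  F x @[x --> a] --> l <->
  forall e : K, 0 < e -> exists2 d : K, 0 < d &
    forall x, `|x - a| < d -> `|F x - l| <= e.
Proof.
split=> [/cvgrPdist_le h e e0|h].
  have /near_normP[d d0 hd] := h e e0.
  by exists d => // x xd; rewrite distrC; exact: hd.
apply/cvgrPdist_le => e e0; have [d d0 hd] := h e e0; apply/near_normP.
by exists d => // x xd; rewrite distrC; exact: hd.
Qed.

Lemma continuous_atD {K : realType} {V W : normedModType K} (F G : V -> W) (a : V) :
  F x @[x --> a] --> F a -> G x @[x --> a] --> G a ->
  F x + G x @[x --> a] --> F a + G a.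
Proof. exact: cvgD. Qed.

Lemma continuous_at_sub {K : realType} {V W : normedModType K} (F : V -> W) (c : W)
    (a : V) : F x @[x --> a] --> F a -> F x - c @[x --> a] --> F a - c.
Proof. by move=> Fa; apply: cvgB => //; exact: cvg_cst. Qed.

Section Continuity.
Context {R : realType}.

Lemma within_continuousP (V W : normedModType R) (A : set V) (F : V -> W) :
  {within A, continuous F} <->
  forall a, A a -> forall e : R, 0 < e -> exists2 d : R, 0 < d &
    forall x, A x -> `|x - a| < d -> `|F x - F a| <= e.
Proof.
split=> [/subspace_continuousP cF a Aa e e0|h].
  have /cvgrPdist_le/(_ e e0) := cF a Aa.
  move=> /(near_normP a)[d d0 hd]; exists d => // x Ax xd; rewrite distrC; exact: hd.
apply/subspace_continuousP => a Aa; apply/cvgrPdist_le => e e0.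
have [d d0 hd] := h a Aa e e0; apply: (near_normP a _).2.
by exists d => // x xd Ax; rewrite distrC; exact: hd.
Qed.

Lemma cvg_coord (V : normedModType R) k (F : V -> 'cV[R]_k) a :
  (forall i, F x i 0 @[x --> a] --> F a i 0) -> F x @[x --> a] --> F a.
Proof.
move=> hF; apply: (cvg_normP (W := 'cV[R]_k) F a _).2 => e e0.
have : \forall z \near a, forall i, `|F z i 0 - F a i 0| <= e.
  apply: (@filter_forall _ _ (fun i z => `|F z i 0 - F a i 0| <= e)) => i.
  have /cvg_normP/(_ e e0)[d d0 hd] := hF i.
  by apply: (near_normP a _).2; exists d.
move=> /(near_normP a)[d d0 hd]; exists d => // z zd.
apply/mx_norm_leP => [|i j]; first exact: ltW.
by rewrite ord1 !mxE; exact: hd.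
Qed.

Lemma within_continuous_coord (V : normedModType R) (D : set V) k
    (F : V -> 'cV[R]_k) :
  (forall i, {within D, continuous (fun z => F z i 0)}) ->
  {within D, continuous F}.
Proof.
move=> hF; apply/within_continuousP => a Da e e0.
have : \forall z \near a, forall i, D z -> `|F z i 0 - F a i 0| <= e.
  apply: (@filter_forall _ _ (fun i z => D z -> `|F z i 0 - F a i 0| <= e)) => i.
  have /within_continuousP/(_ a Da e e0)[d d0 hd] := hF i.
  by apply: (near_normP a _).2; exists d => // z zd Dz; exact: hd.
move=> /(near_normP a)[d d0 hd]; exists d => // z Dz zd.
apply/mx_norm_leP => [|i j]; first exact: ltW.
by rewrite ord1 !mxE; exact: hd.
Qed.

Lemma continuous_mulmx_fun (V : normedModType R) k l (G : V -> 'M[R]_(k, l))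
    (v : V -> 'cV[R]_l) : continuous G -> continuous v ->
  continuous (fun x => G x *m v x).
Proof.
move=> cG cv a; apply: cvg_coord => i.
rewrite [X in X @ _](_ : _ = fun x => \sum_j G x i j * v x j 0); last first.
  by apply/funext => x; rewrite mxE.
rewrite mxE; apply: cvg_big => [|j _]; first exact: add_continuous.
have Gij : G x i j @[x --> a] --> G a i j.
  exact: (continuous_comp (@cG a) (@coord_continuous R k l i j (G a))).
have vj : v x j 0 @[x --> a] --> v a j 0.
  exact: (continuous_comp (@cv a) (@coord_continuous R l 1 j 0 (v a))).
exact: cvgM.
Qed.

End Continuity.

(** * First-order expansions of vector functions *)

Section Jacobian.
Context {R : realType}.

(** Differentiability at [a] with matrix [M] acting on columns, in the form in
    which the estimates below produce and use it; see [has_jacP]. *)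
Definition has_jac n k (F : 'cV[R]_n -> 'cV[R]_k) (a : 'cV[R]_n)
    (M : 'M[R]_(k, n)) : Prop :=
  forall e : R, 0 < e ->
    \forall x \near a, `|F x - F a - M *m (x - a)| <= e * `|x - a|.

Lemma mulmx_continuous m n p (M : 'M[R]_(m, n)) :
  continuous (mulmx M : 'M[R]_(n, p) -> 'M[R]_(m, p)).
Proof.
apply/linear_bounded_continuous; exists (n%:R * `|M|); split; first exact: num_real.
move=> e Me; apply: (near_normP (0 : 'M[R]_(n,p)) (fun x => `|M *m x| <= e)).2.
exists 1 => //= x.
rewrite subr0 => x1.
apply: le_trans (ler_norm_mulmx _ _) _; apply: le_trans (ltW Me).
by rewrite ler_piMr ?mulr_ge0 // ltW.
Qed.

Lemma diff_has_jac n k (F : 'cV[R]_n -> 'cV[R]_k) a :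
  differentiable F a -> has_jac F a (Jac F a).
Proof.
move=> dF e e0; have dFE v : 'd F a v = Jac F a *m v.
  rewrite [v in LHS](_ : v = \sum_i v i 0 *: delta_mx i 0); last first.
    apply/colP => i; rewrite summxE (bigD1 i) //= !mxE !eqxx mulr1 big1 ?addr0 //.
    by move=> j ji; rewrite !mxE eq_sym (negbTE ji) mulr0.
  rewrite linear_sum; apply/colP => i; rewrite summxE mxE; apply: eq_bigr => j _.
  by rewrite linearZ /= !mxE deriveE // mulrC.
have /eqaddoP/(_ _ e0) := diff_locally dF.
move=> /near_normP[d d0 h]; apply/near_normP; exists d => // x xd.
have := h (x - a); rewrite subr0 => /(_ xd) /=.
by rewrite !fctE /= subrK dFE opprD addrA.
Qed.

Lemma has_jacP n k (F : 'cV[R]_n -> 'cV[R]_k) a M :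
  has_jac F a M <-> differentiable F a /\ Jac F a = M.
Proof.
split=> [h|[dF <-]]; last exact: diff_has_jac.
pose V : normedModType R := 'cV[R]_n; pose W : normedModType R := 'cV[R]_k.
pose L : {linear V -> W} := mulmx M.
have eqo : (F : V -> W) \o shift (a : V) = cst (F a : W) + (L : V -> W) +o_ (0 : V) id.
  apply/eqaddoP => e e0; have /near_normP[d d0 hd] := h e e0.
  apply: (near_normP (0 : V) _).2; exists d => // x; rewrite subr0 => xd.
  have := hd (x + a); rewrite addrK => /(_ xd).
  by rewrite !fctE /= opprD addrA.
have dFE : 'd F a = L :> (V -> W) := diff_unique (@mulmx_continuous _ _ 1 M) eqo.
have dF : differentiable F a.
  apply/diff_locallyP; rewrite dFE; split => //; exact: mulmx_continuous.
split=> //; apply/matrixP => i j; rewrite mxE deriveE // dFE.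
by rewrite [L _](_ : _ = col j M) ?mxE // colE.
Qed.

Lemma has_jac_lip n k (F : 'cV[R]_n -> 'cV[R]_k) a M : has_jac F a M ->
  \forall x \near a, `|F x - F a| <= (n%:R * `|M| + 1) * `|x - a|.
Proof.
move=> /(_ 1 ltr01); apply: filterS => x; rewrite mul1r => h.
rewrite -[F x - F a](subrK (M *m (x - a))) addrC.
apply: le_trans (ler_normD _ _) _; rewrite mulrDl mul1r lerD //.
exact: ler_norm_mulmx.
Qed.

Lemma has_jac_cvg n k (F : 'cV[R]_n -> 'cV[R]_k) a M :
  has_jac F a M -> F x @[x --> a] --> F a.
Proof. by move=> /has_jacP[/differentiable_continuous]. Qed.

Lemma has_jac_comp n k l (F : 'cV[R]_n -> 'cV[R]_k) (G : 'cV[R]_k -> 'cV[R]_l)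
    a M N :
  has_jac F a M -> has_jac G (F a) N -> has_jac (G \o F) a (N *m M).
Proof.
move=> hF hG e e0; have cF := has_jac_cvg hF; have lF := has_jac_lip hF.
set C := n%:R * `|M| + 1 in lF; have C0 : 0 < C by rewrite ltr_wpDl // mulr_ge0.
set D := k%:R * `|N| + 1; have D0 : 0 < D by rewrite ltr_wpDl // mulr_ge0.
have e1 : 0 < e / 2 / C by rewrite !divr_gt0.
have e2 : 0 < e / 2 / D by rewrite !divr_gt0.
near=> x; rewrite /=.
have h1 : `|G (F x) - G (F a) - N *m (F x - F a)| <= e / 2 / C * `|F x - F a|.
  by near: x; exact: (cF _ (hG _ e1)).
have h2 : `|F x - F a - M *m (x - a)| <= e / 2 / D * `|x - a|.
  by near: x; exact: hF.
have h3 : `|F x - F a| <= C * `|x - a| by near: x.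
have -> : G (F x) - G (F a) - (N *m M) *m (x - a) =
  (G (F x) - G (F a) - N *m (F x - F a)) + N *m (F x - F a - M *m (x - a)).
  by rewrite [N *m (_ - M *m _)]mulmxBr mulmxA addrA subrK.
apply: le_trans (ler_normD _ _) _; rewrite [e]splitr mulrDl lerD //.
  apply: le_trans h1 _; rewrite -mulrA ler_pM2l ?divr_gt0 //.
  by rewrite ler_pdivrMl.
apply: le_trans (ler_norm_mulmx _ _) _.
apply: (@le_trans _ _ (D * `|F x - F a - M *m (x - a)|)).
  by rewrite ler_wpM2r // lerDl.
by rewrite mulrC -ler_pdivlMr // mulrAC.
Unshelve. all: by end_near. Qed.

Lemma eq_near_has_jac n k (F G : 'cV[R]_n -> 'cV[R]_k) a M :
  (\forall x \near a, F x = G x) -> has_jac F a M -> has_jac G a M.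
Proof.
move=> FG hF e e0; have FGa := nbhs_singleton FG.
near=> x; rewrite -FGa -(near FG x) //; near: x; exact: hF.
Unshelve. all: by end_near. Qed.

Lemma eq_has_jac n k (F G : 'cV[R]_n -> 'cV[R]_k) a M :
  F =1 G -> has_jac F a M -> has_jac G a M.
Proof. by move=> /funext ->. Qed.

Lemma has_jacD n k (F G : 'cV[R]_n -> 'cV[R]_k) a M N :
  has_jac F a M -> has_jac G a N -> has_jac (fun x => F x + G x) a (M + N).
Proof.
move=> hF hG e e0; have e2 : 0 < e / 2 by rewrite divr_gt0.
near=> x.
have -> : F x + G x - (F a + G a) - (M + N) *m (x - a) =
    (F x - F a - M *m (x - a)) + (G x - G a - N *m (x - a)).
  by rewrite mulmxDl !opprD !addrA; do ![rewrite (addrAC _ (G x))]; rewrite !(addrAC _ (- G a)).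
apply: le_trans (ler_normD _ _) _; rewrite [e]splitr mulrDl lerD //.
  by near: x; exact: hF.
by near: x; exact: hG.
Unshelve. all: by end_near. Qed.

Lemma has_jac_affine n k (M : 'M[R]_(k, n)) c b a :
  has_jac (fun x => M *m (x - c) + b) a M.
Proof.
move=> e e0; near=> x.
rewrite (_ : _ - _ = 0) ?normr0 ?mulr_ge0 // ?ltW //.
apply/eqP; rewrite subr_eq0; apply/eqP.
by rewrite opprD addrACA subrr addr0 -mulmxBr opprB addrA subrK.
Unshelve. all: by end_near. Qed.

Lemma has_jac_col_mx n k l (F : 'cV[R]_n -> 'cV[R]_k) (G : 'cV[R]_n -> 'cV[R]_l)
    a M N :
  has_jac F a M -> has_jac G a N ->
  has_jac (fun x => col_mx (F x) (G x)) a (col_mx M N).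
Proof.
move=> hF hG e e0; near=> x.
rewrite mul_col_mx opp_col_mx add_col_mx opp_col_mx add_col_mx.
by apply: norm_le_col_mx; near: x; [exact: hF|exact: hG].
Unshelve. all: by end_near. Qed.

Lemma has_jac_coord n k (F : 'cV[R]_n -> 'cV[R]_k) a (M : 'M[R]_(k, n)) :
  (forall i (e : R), 0 < e -> \forall x \near a,
     `|F x i 0 - F a i 0 - \sum_j M i j * (x j 0 - a j 0)| <= e * `|x - a|) ->
  has_jac F a M.
Proof.
move=> h e e0.
have : \forall x \near a, forall i,
    `|F x i 0 - F a i 0 - \sum_j M i j * (x j 0 - a j 0)| <= e * `|x - a|.
  exact: (@filter_forall _ _ (fun i x => `|F x i 0 - F a i 0 -
    \sum_j M i j * (x j 0 - a j 0)| <= e * `|x - a|) _ _ (fun i => h i e e0)).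
apply: filterS => x hx; apply/mx_norm_leP => [|i j]; first by rewrite mulr_ge0 // ltW.
rewrite ord1 !mxE; have := hx i; congr (`|_ - _| <= _).
by apply: eq_bigr => l _; rewrite !mxE.
Qed.

(** An error bound that involves [u] itself is as good as one in [x - x0] alone:
    taking [e = 1/2] first absorbs [|u x - u x0|] and shows that it is [O(x - x0)]. *)
Lemma has_jac_implicit n m (u : 'cV[R]_n -> 'cV[R]_m) x0 (K : 'M[R]_(m, n)) :
  (forall e : R, 0 < e -> \forall x \near x0,
     `|u x - u x0 - K *m (x - x0)| <= e * (`|u x - u x0| + `|x - x0|)) ->
  has_jac u x0 K.
Proof.
move=> hu e e0; have half0 : 0 < 2^-1 :> R by rewrite invr_gt0.
have k0 : 0 <= n%:R * `|K| by rewrite mulr_ge0.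
set k := n%:R * `|K| in k0.
have e1 : 0 < e / (2 * k + 2) by rewrite divr_gt0 // ltr_wpDl // mulr_ge0.
(* [d1] serves the Lipschitz bound with constant [2 k + 1], [d2] the expansion *)
have /near_normP[d1 d10 h1] := hu _ half0.
have /near_normP[d2 d20 h2] := hu _ e1.
apply: (near_normP x0 _).2; exists (Num.min d1 d2); first by rewrite lt_min d10.
move=> x; rewrite lt_min => /andP[xd1 xd2]; apply: le_trans (h2 x xd2) _.
have uk : `|u x - u x0| <= (2 * k + 1) * `|x - x0|.
  have hK := ler_norm_mulmx K (x - x0); rewrite -/k in hK.
  have := ler_normD (u x - u x0 - K *m (x - x0)) (K *m (x - x0)); rewrite subrK.
  have := h1 x xd1; move: hK; rewrite mulrDl; lra.
apply: (@le_trans _ _ (e / (2 * k + 2) * ((2 * k + 2) * `|x - x0|))).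
  by rewrite ler_pM2l //; lra.
by rewrite mulrA divfK // gt_eqF // ltr_wpDl // mulr_ge0.
Qed.

End Jacobian.

(** * Directional derivatives *)

Section Derivative.
Context {R : realType}.

Lemma is_derive_dirP (V W : normedModType R) (f : V -> W) (a v : V) (c : W) :
  is_derive a v f c <->
  forall e : R, 0 < e -> exists2 d : R, 0 < d &
    forall h, `|h| < d -> `|f (a + h *: v) - f a - h *: c| <= e * `|h|.
Proof.
split=> [[df <-] e e0|hf].
  have := df; rewrite /derivable -/(derive f a v) => /cvgrPdist_le/(_ e e0).
  move=> /(near_normP (0 : R))[d d0 hd]; exists d => // h hlt.
  have [->|h0] := eqVneq h 0.
    by rewrite !scale0r addr0 !subrr !normr0 mulr0.
  have := hd h; rewrite subr0 => /(_ hlt h0) /=.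
  rewrite -(ler_pM2l (x := `|h|)) ?normr_gt0 // -normrZ scalerBr.
  by rewrite scalerA divff // scale1r distrC [_ *: v + a]addrC [e * _]mulrC.
have cvg : (fun h => h^-1 *: (f (h *: v + a) - f a)) @ (0 : R)^' --> c.
  apply/cvgrPdist_le => e e0; have [d d0 hd] := hf e e0.
  apply: (near_normP (0 : R) _).2; exists d => // k; rewrite subr0 => kd k0.
  have := hd k kd; rewrite [_ *: v + a]addrC => hk.
  rewrite -(ler_pM2l (x := `|k|)) ?normr_gt0 // -normrZ scalerBr.
  by rewrite scalerA divff // scale1r distrC [_ * e]mulrC.
split; first by apply/cvg_ex; exists c.
exact: cvg_lim cvg.
Qed.

Lemma is_derive_normP (V : normedModType R) (y : R -> V) (t : R) (c : V) :
  is_derive t 1 y c <->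
  forall e : R, 0 < e -> exists2 d : R, 0 < d &
    forall h, `|h| < d -> `|y (t + h) - y t - h *: c| <= e * `|h|.
Proof.
split=> [/is_derive_dirP hy|hy]; last apply/is_derive_dirP; move=> e /hy[d d0 hd].
  by exists d => // h /hd; rewrite [h *: 1]mulr1.
by exists d => // h /hd; rewrite [h *: 1]mulr1.
Qed.

End Derivative.

(** * Compact boxes and ultrafilter limits *)

Section Compactness.
Context {R : realType}.

Lemma trmx_continuous m n : continuous (trmx : 'M[R]_(m, n) -> 'M[R]_(n, m)).
Proof.
apply/linear_bounded_continuous; exists 1; split; first exact: num_real.
move=> e e1; apply: (near_normP (0 : 'M[R]_(m, n)) (fun x => `|x^T| <= e)).2.
exists 1 => //= x; rewrite subr0 norm_trmx => x1; exact: ltW (lt_trans x1 e1).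
Qed.

Lemma box_compact m (lo hi : 'cV[R]_m) : compact (box lo hi).
Proof.
have := @rV_compact R m (fun i => `[lo i 0, hi i 0]%classic)
  (fun i => @segment_compact R _ _).
move=> /(continuous_compact (continuous_subspaceT (@trmx_continuous 1 m))).
congr compact; apply/seteqP; split=> [v [w wP <-] i|v vP]; rewrite /= ?mxE.
  by have := wP i; rewrite /= in_itv.
by exists v^T; rewrite ?trmxK // => i; rewrite mxE /= in_itv; exact: vP.
Qed.

(** Simultaneous pointwise convergence of a family of bounded sequences needs no
    diagonal extraction: one ultrafilter serves all of them. *)
Lemma bounded_ultra_cvg T (G : set_system T) m (y : T -> 'cV[R]_m) (C : R) :
  UltraFilter G -> (forall t, `|y t| <= C) -> exists l : 'cV[R]_m, y @ G --> l.
Proof.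
move=> GU yC; have /(_ (y @ G) _)[] := @box_compact m (\col__ - C) (\col__ C).
  have : G [set t | box (\col__ - C) (\col__ C) (y t)]; last by [].
  apply: filterE => t i; rewrite !mxE -ler_norml.
  exact: le_trans (ler_mx_coord _ _ _) (yC t).
move=> l [_ cl]; exists l => W Wl.
have [//|GW] := in_ultra_setVsetC (y @^-1` W) GU.
by have [x [nWx Wx]] := cl (~` W) W GW Wl.
Qed.

End Compactness.

(** * Existence of solutions for a bounded field *)

Section Peano.
Context {R : realType} {n : nat}.
Variables (g : 'cV[R]_n -> 'cV[R]_n) (M : R).
Hypothesis gM : forall x, `|g x| <= M.

Let M0 : 0 <= M. Proof. exact: le_trans (normr_ge0 _) (gM 0). Qed.

Definition euler (x0 : 'cV[R]_n) (k j : nat) : 'cV[R]_n :=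
  iter j (fun x => x + k.+1%:R^-1 *: g x) x0.

(** The Euler scheme as a step function of time.  Negative times are truncated to
    the initial state. *)
Definition euler_step (x0 : 'cV[R]_n) (k : nat) (t : R) : 'cV[R]_n :=
  euler x0 k (Num.truncn (t * k.+1%:R)).

(** If the field stays within [e] of [c] along [d] consecutive steps, the
    displacement stays within [e] of the uniform motion with velocity [c]. *)
Lemma euler_dist x0 k c (e : R) i d :
  (forall l, (i <= l < i + d)%N -> `|g (euler x0 k l) - c| <= e) ->
  `|euler x0 k (i + d) - euler x0 k i - (d%:R / k.+1%:R) *: c|
     <= d%:R / k.+1%:R * e.
Proof.
elim: d => [|d IHd] h.
  by rewrite addn0 subrr !mul0r scale0r subrr normr0.
have {}IHd : `|euler x0 k (i + d) - euler x0 k i - (d%:R / k.+1%:R) *: c|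
     <= d%:R / k.+1%:R * e.
  by apply: IHd => l /andP[il ld]; rewrite h // il addnS ltnW.
rewrite addnS /= -/(euler x0 k (i + d)).
have -> : euler x0 k (i + d) + k.+1%:R^-1 *: g (euler x0 k (i + d))
    - euler x0 k i - (d.+1%:R / k.+1%:R) *: c =
  (euler x0 k (i + d) - euler x0 k i - (d%:R / k.+1%:R) *: c)
  + k.+1%:R^-1 *: (g (euler x0 k (i + d)) - c).
  apply/colP => l; rewrite !mxE -natr1; ring.
apply: le_trans (ler_normD _ _) _.
rewrite -[d.+1%:R]natr1 2!mulrDl mul1r lerD //.
rewrite normrZ ger0_norm ?invr_ge0 // ler_pM2l ?invr_gt0 //.
by apply: h; rewrite leq_addr addnS ltnS leqnn.
Qed.

Lemma euler_lip x0 k i j : (i <= j)%N ->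
  `|euler x0 k j - euler x0 k i| <= (j - i)%:R / k.+1%:R * M.
Proof.
move=> ij; have := @euler_dist x0 k 0 M i (j - i).
rewrite subnKC // scaler0 subr0; apply=> l _; by rewrite subr0.
Qed.

Lemma truncn_step (s t : R) (k : nat) : 0 <= s -> s <= t ->
  let i := Num.truncn (s * k.+1%:R) in let j := Num.truncn (t * k.+1%:R) in
  (i <= j)%N /\ `|(j - i)%:R / k.+1%:R - (t - s)| <= k.+1%:R^-1 :> R.
Proof.
move=> s0 st i j; have k0 : 0 < k.+1%:R :> R by [].
have ij : (i <= j)%N by apply: le_truncn; rewrite ler_pM2r.
split=> //.
have /andP[i1 i2] : i%:R <= s * k.+1%:R < i.+1%:R by rewrite truncn_itv ?mulr_ge0.
have /andP[j1 j2] : j%:R <= t * k.+1%:R < j.+1%:R.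
  by rewrite truncn_itv ?mulr_ge0 // (le_trans s0).
rewrite -(ler_pM2r k0) mulVf ?gt_eqF // -[X in _ * X](gtr0_norm k0) -normrM.
rewrite mulrBl divfK ?gt_eqF // natrB // ler_norml.
move: i2 j2; rewrite -!natr1 => i2 j2; apply/andP; split; lra.
Qed.

(** Peano's theorem.  The limit solves the equation at each time where the field
    happens to be continuous at the state reached; this allows a field that has been
    cut off discontinuously far from the states of interest. *)
Lemma peano_bounded (x0 : 'cV[R]_n) : exists y : R -> 'cV[R]_n,
  [/\ y 0 = x0,
      (forall s t, 0 <= s -> s <= t -> `|y t - y s| <= (t - s) * M) &
      forall t, 0 < t -> {for y t, continuous g} -> is_derive t 1 y (g (y t))].
Proof.
have [G [GU sG]] := ultraFilterLemma (@eventually_filter).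
have small (e : R) : 0 < e -> G [set k | k.+1%:R^-1 < e].
  move=> e0; apply: sG; have := near_infty_natSinv_lt (PosNum e0).
  by apply: filterS.
have bnd t k : `|euler_step x0 k t| <= `|x0| + `|t| * M.
  rewrite -[euler_step _ _ _](subrK x0) addrC.
  apply: le_trans (ler_normD _ _) _; rewrite lerD2l.
  apply: le_trans (euler_lip _ _ (leq0n _)) _; rewrite ler_wpM2r // subn0.
  rewrite ler_pdivrMr //; have [t0|t0] := leP 0 t.
    by rewrite ger0_norm // truncn_le mulr_ge0.
  rewrite (_ : Num.truncn _ = 0%N) ?mulr_ge0 //; apply/truncn0Pn.
  by rewrite -ltNge (lt_trans _ ltr01) // pmulr_llt0.
pose y t := lim (euler_step x0 ^~ t @ G).
have yl t : euler_step x0 ^~ t @ G --> y t.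
  by apply/cvg_ex; exact: (bounded_ultra_cvg GU (bnd t)).
exists y.
(* Between [s] and [t] the polygons move by at most [(t - s) M < d] up to a
   vanishing error, so they stay where [g] is [e]-close to [c]; the bound on their
   increments passes to the limit.  With [c = 0] and [e = M] it is the Lipschitz
   bound, with [c = g (y t)] it is differentiability at [t]. *)
have key s t tau c (e d : R) : 0 <= s -> s <= tau -> tau <= t ->
    0 <= e -> (forall x, `|x - y tau| < d -> `|g x - c| <= e) ->
    (t - s) * M < d -> `|y t - y s - (t - s) *: c| <= (t - s) * e.
  move=> s0 stau taut e0 gc Md; apply/ler_addgt0Pr => r r0.
  pose eta := d - (t - s) * M; have eta0 : 0 < eta by rewrite subr_gt0.
  have near1 u (r' : R) : 0 < r' -> G [set k | `|y u - euler_step x0 k u| < r'].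
    by move=> r'0; move/cvgrPdist_lt : (yl u) => /(_ _ r'0).
  have r3 : 0 < r / 3 by rewrite divr_gt0.
  have b4 : 0 < r / 3 / (e + `|c| + 1) by rewrite divr_gt0 // ltr_wpDl // addr_ge0.
  have b5 : 0 < eta / 2 / (M + 1) by rewrite !divr_gt0 // ltr_wpDl.
  have b3 : 0 < eta / 2 by rewrite divr_gt0.
  have GI (A B : set nat) : G A -> G B -> G (A `&` B) by apply: filterI.
  have /filter_ex[k [[[k1 k2] k3] [k4 k5]]] :=
    GI _ _ (GI _ _ (GI _ _ (near1 t _ r3) (near1 s _ r3)) (near1 tau _ b3))
      (GI _ _ (small _ b4) (small _ b5)).
  move: k1 k2 k3 k4 k5; rewrite /= {1 2 3}/euler_step.
  have [ij qts] := truncn_step k s0 (le_trans stau taut).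
  have [il0 _] := truncn_step k s0 stau.
  have [l0j _] := truncn_step k (le_trans s0 stau) taut.
  move: ij qts il0 l0j.
  set i := Num.truncn (s * _); set j := Num.truncn (t * _).
  set l0 := Num.truncn (tau * _) => ij qts il0 l0j k1 k2 k3 k4 k5.
  set q := (j - i)%:R / k.+1%:R in qts; set w := k.+1%:R^-1 in qts k4 k5.
  have w0 : 0 < w by rewrite invr_gt0.
  have dist l : (i <= l < j)%N -> `|euler x0 k l - euler x0 k l0| <= q * M.
    move=> /andP[il lj]; have [ll0|/ltnW ll0] := leqP l l0.
      rewrite distrC; apply: le_trans (euler_lip _ _ ll0) _.
      by rewrite ler_wpM2r // ler_pM2r ?invr_gt0 // ler_nat leq_sub.
    apply: le_trans (euler_lip _ _ ll0) _.
    by rewrite ler_wpM2r // ler_pM2r ?invr_gt0 // ler_nat leq_sub // ltnW.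
  have qw : q <= (t - s) + w by move: qts; rewrite ler_norml => /andP[_]; lra.
  have wM : w * M <= eta / 2.
    move: k5; rewrite ltr_pdivlMr ?ltr_wpDl // => k5.
    by apply: ltW; apply: le_lt_trans k5; rewrite ler_pM2l // lerDl.
  have gl l : (i <= l < i + (j - i))%N -> `|g (euler x0 k l) - c| <= e.
    rewrite subnKC // => lP; apply: gc.
    rewrite -[_ - y tau](subrKA (euler x0 k l0)).
    apply: le_lt_trans (ler_normD _ _) _.
    have -> : d = (t - s) * M + eta / 2 + eta / 2.
      by rewrite -addrA -splitr /eta addrC subrK.
    rewrite ler_ltD //; last by rewrite distrC.
    apply: le_trans (dist l lP) _; apply: (@le_trans _ _ ((t - s + w) * M)).
      by rewrite ler_wpM2r.
    by rewrite mulrDl lerD2l.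
  have := euler_dist gl; rewrite subnKC // -/q => E.
  have -> : y t - y s - (t - s) *: c =
     (y t - euler x0 k j) - (y s - euler x0 k i)
     + (q - (t - s)) *: c + (euler x0 k j - euler x0 k i - q *: c).
    by apply/colP => a; rewrite !mxE; ring.
  apply: le_trans (ler_normD _ _) _; rewrite [_ + r]addrC.
  have : `|y t - euler x0 k j - (y s - euler x0 k i) + (q - (t - s)) *: c|
      <= r / 3 + r / 3 + w * `|c|.
    apply: le_trans (ler_normD _ _) _; rewrite normrZ lerD //; last first.
      by rewrite ler_wpM2r.
    by apply: le_trans (ler_normB _ _) _; rewrite lerD // ltW.
  move: k4; rewrite ltr_pdivlMr; last by rewrite ltr_wpDl // addr_ge0.
  move=> k4 h1; have qe : q * e <= (t - s) * e + w * e.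
    by rewrite -mulrDl ler_wpM2r.
  have -> : r + (t - s) * e = r / 3 + r / 3 + r / 3 + (t - s) * e by field.
  move: k4; rewrite !mulrDr mulr1 => k4; lra.
split.
- rewrite /y (_ : euler_step x0 ^~ 0 = cst x0); first exact: lim_cst.
  by apply/funext => k; rewrite /euler_step mul0r truncn0.
- move=> s t s0 st.
  have := @key s t s 0 M ((t - s) * M + 1) s0 (lexx s) st M0.
  rewrite scaler0 subr0; apply=> [x _|]; first by rewrite subr0.
  by rewrite ltrDl.
- move=> t t0 gt; apply/is_derive_normP => e e0.
  have {}gt : g x @[x --> y t] --> g (y t) by [].
  move/cvgrPdist_le : gt => /(_ e e0) /near_normP[d d0 hd].
  have M1 : 0 < M + 1 by rewrite ltr_wpDl.
  exists (Num.min t (d / (M + 1))); first by rewrite lt_min t0 divr_gt0.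
  move=> h; rewrite lt_min => /andP[ht hM].
  have hd' : `|h| * M < d.
    move: hM; rewrite ltr_pdivlMr // => hM.
    by apply: le_lt_trans hM; rewrite ler_wpM2l // lerDl.
  have gc x : `|x - y t| < d -> `|g x - g (y t)| <= e.
    by move=> xd; rewrite distrC; exact: hd.
  have [h0|/ltW h0] := leP 0 h.
    have := @key t (t + h) t (g (y t)) e d (ltW t0) (lexx t).
    move: hd'; rewrite lerDl addrAC subrr add0r (ger0_norm h0) [e * _]mulrC => hd'.
    by move=> /(_ h0 (ltW e0) gc hd').
  have := @key (t + h) t t (g (y t)) e d.
  rewrite (_ : t - (t + h) = - h); last by rewrite opprD addrA subrr add0r.
  rewrite lexx gerDl -(ler0_norm h0) => /(_ _ h0 isT (ltW e0) gc hd').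
  rewrite (_ : `|h| *: g (y t) = - (h *: g (y t))); last first.
    by rewrite ler0_norm // scaleNr.
  rewrite opprK -normrN opprD opprB [e * _]mulrC; apply.
  by move: ht; rewrite ler0_norm // => ht; rewrite -[h]opprK subr_ge0 ltW.
Qed.

End Peano.

(** * Strict quadratic Lyapunov functions *)

Section QuadraticForms.
Context {R : realType} {n : nat}.
Implicit Types (M A S W : 'M[R]_n) (u v x : 'cV[R]_n).

Definition bform M u v : R := (u^T *m M *m v) 0 0.
Definition qform M x : R := bform M x x.

Lemma bformDl M u1 u2 v : bform M (u1 + u2) v = bform M u1 v + bform M u2 v.
Proof. by rewrite /bform linearD /= !mulmxDl mxE. Qed.

Lemma bformDr M u v1 v2 : bform M u (v1 + v2) = bform M u v1 + bform M u v2.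
Proof. by rewrite /bform mulmxDr mxE. Qed.

Lemma bformZl M a u v : bform M (a *: u) v = a * bform M u v.
Proof. by rewrite /bform linearZ /= -!scalemxAl mxE. Qed.

Lemma bformZr M a u v : bform M u (a *: v) = a * bform M u v.
Proof. by rewrite /bform -scalemxAr mxE. Qed.

Lemma qformZ M a x : qform M (a *: x) = a ^+ 2 * qform M x.
Proof. by rewrite /qform bformZl bformZr mulrA expr2. Qed.

Lemma qform_mxD M N x : qform (M + N) x = qform M x + qform N x.
Proof. by rewrite /qform /bform mulmxDr mulmxDl mxE. Qed.

Lemma qform_mxZ a M x : qform (a *: M) x = a * qform M x.
Proof. by rewrite /qform /bform -scalemxAr -scalemxAl mxE. Qed.

Lemma qform_mxN M x : qform (- M) x = - qform M x.
Proof. by rewrite -scaleN1r qform_mxZ mulN1r. Qed.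

(** The factors [n] come from the sup norm, for which
    [|A *m B| <= n |A| |B|]. *)
Definition bform_bound M : R := n%:R * (n%:R * `|M|).

Lemma bform_bound_ge0 M : 0 <= bform_bound M.
Proof. by rewrite !mulr_ge0. Qed.

Lemma ler_bform M u v : `|bform M u v| <= bform_bound M * `|u| * `|v|.
Proof.
rewrite /bform norm_mx11; apply: le_trans (ler_norm_mulmx _ _) _.
rewrite ler_wpM2r // -mulrA ler_wpM2l //.
by apply: le_trans (ler_norm_mulmx _ _) _; rewrite norm_trmx mulrAC.
Qed.

Lemma qform_continuous M : continuous (qform M).
Proof.
move=> a; apply: (cvg_normP (V := 'cV[R]_n) (qform M) a _).2 => e e0.
set C := bform_bound M; have C0 : 0 <= C := bform_bound_ge0 M.
set D := C * (2 * `|a| + 1); have D0 : 0 <= D by rewrite mulr_ge0 // addr_ge0 // mulr_ge0.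
exists (Num.min 1 (e / (D + 1))); first by rewrite lt_min ltr01 divr_gt0 // ltr_wpDl.
move=> x; rewrite lt_min => /andP[x1 xe].
have -> : qform M x - qform M a = (bform M (x - a) a + bform M a (x - a)
    + bform M (x - a) (x - a)).
  have -> : qform M x = qform M (a + (x - a)) by rewrite addrC subrK.
  by rewrite /qform !bformDl !bformDr; ring.
apply: (@le_trans _ _ (D * `|x - a|)).
  apply: (@le_trans _ _ (C * `|x - a| * `|a| + C * `|a| * `|x - a| + C * `|x - a| * 1)).
    apply: le_trans (ler_normD _ _) _; apply: lerD.
      by apply: le_trans (ler_normD _ _) _; apply: lerD; exact: ler_bform.
    apply: le_trans (ler_bform _ _ _) _.
    by rewrite ler_wpM2l // ?mulr_ge0 // ltW.
  by rewrite (_ : D * _ = C * `|x - a| * `|a| + C * `|a| * `|x - a| + C * `|x - a| * 1) // /D; ring.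
move: xe; rewrite ltr_pdivlMr ?ltr_wpDl // => xe.
by apply: ltW; apply: le_lt_trans xe; rewrite mulrC ler_wpM2l // lerDl.
Qed.

Lemma compact_sphereI (V : set 'cV[R]_n) : closed V ->
  compact (V `&` [set x | `|x| = 1]).
Proof.
move=> cV; apply: (subclosed_compact _ (@box_compact R n (\col__ -1) (\col__ 1))).
  apply: closedI => //.
  rewrite (_ : [set _ | _] = Num.Def.normr @^-1` [set 1 : R]) //.
  apply: preimage_closed; last exact: closed_eq.
  by move=> x _; exact: norm_continuous.
move=> x [_ /= x1] i; rewrite !mxE -ler_norml -x1; exact: ler_mx_coord.
Qed.

(** Finsler's lemma.  On the compact part of [K] where [b <= 0] the function [a] is
    bounded below by a positive constant, which outweighs [e b] for small [e];
    elsewhere both terms help. *)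
Lemma finsler (K : set 'cV[R]_n) (a b : 'cV[R]_n -> R) :
  compact K -> continuous a -> continuous b ->
  (forall x, K x -> 0 <= a x) -> (forall x, K x -> a x = 0 -> 0 < b x) ->
  exists2 e0, 0 < e0 & forall e x, 0 < e -> e <= e0 -> K x -> 0 < a x + e * b x.
Proof.
move=> cK ca cb a0 b0.
pose N := K `&` [set x | b x <= 0].
have cN : compact N.
  rewrite /N; apply: compact_closedI => //.
  apply: (@preimage_closed _ _ b [set y | y <= 0]) => [x _|]; first exact: cb.
  exact: closed_le.
have [[x0 Nx0]|N0] := pselect (N !=set0); last first.
  exists 1 => // e x e0 _ Kx; have bx : 0 < b x.
    by rewrite ltNge; apply/negP => bx; apply: N0; exists x.
  by rewrite ltr_wpDl ?a0 // mulr_gt0.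
have [p Np pmin] := compact_EVT_min (ex_intro _ x0 Nx0) cN (continuous_subspaceT ca).
have [q Nq qmin] := compact_EVT_min (ex_intro _ x0 Nx0) cN (continuous_subspaceT cb).
move: Np Nq; rewrite !inE => -[Kp bp] [Kq bq].
have ap : 0 < a p.
  rewrite lt_neqAle a0 // andbT; apply/eqP => ap0.
  by have := b0 p Kp (esym ap0); rewrite ltNge bp.
have D0 : 0 < 1 - b q by rewrite ltr_pwDl // oppr_ge0.
(* [1 - b q] is at least [1], also when the minimum [b q] is [0] *)
exists (a p / (1 - b q)); first by rewrite divr_gt0.
move=> e x e0 ele Kx; have [bx|bx] := leP (b x) 0; last first.
  by rewrite ltr_wpDl ?a0 // mulr_gt0.
have Nx : x \in N by rewrite inE.
have h1 := pmin _ Nx; have h2 := qmin _ Nx.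
move: ele; rewrite ler_pdivlMr // => ele.
have : e * b q <= e * b x by rewrite ler_pM2l.
move: ele; rewrite mulrBr mulr1; lra.
Qed.

(** Finsler's lemma with the constant function [b = -1], followed by scaling. *)
Lemma qform_coercive M : (forall x, x != 0 -> 0 < qform M x) ->
  exists2 c, 0 < c & forall x, c * `|x| ^+ 2 <= qform M x.
Proof.
move=> M0; have [] := @finsler (setT `&` [set x | `|x| = 1]) (qform M) (fun=> -1)
  (compact_sphereI closedT) (@qform_continuous M) (@cst_continuous _ _ (-1 : R)).
- by move=> x [_ /= x1]; rewrite ltW // M0 // -normr_eq0 x1 oner_eq0.
- move=> x [_ /= x1] qx; have := M0 x; rewrite qx ltxx -normr_eq0 x1 oner_eq0.
  by move=> /(_ isT).
move=> c c0 h; exists c => // x; have [->|x0] := eqVneq x 0.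
  by rewrite normr0 expr0n mulr0 /qform /bform mulmx0 mxE.
have nx : `|x| != 0 by rewrite normr_eq0.
have : (setT `&` [set x | `|x| = 1]) (`|x|^-1 *: x : 'cV[R]_n).
  by split=> //=; rewrite normrZ normfV normr_id mulVf.
move=> /(h c _ c0 (lexx c)); rewrite /= qformZ mulrN1 subr_gt0 exprVn => /ltW.
by rewrite ler_pdivlMl ?exprn_gt0 ?normr_gt0 // mulrC.
Qed.

(** The matrix of the derivative of [x^T W x] along [x' = A x]. *)
Definition lie A W : 'M[R]_n := A^T *m W + W *m A.

Lemma qform_lie A W x : qform (lie A W) x = bform W (A *m x) x + bform W x (A *m x).
Proof.
by rewrite qform_mxD /qform /bform trmx_mul !mulmxA.
Qed.

Lemma lieD A W1 W2 : lie A (W1 + W2) = lie A W1 + lie A W2.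
Proof. by rewrite /lie mulmxDr mulmxDl addrACA. Qed.

Lemma lieZ A a W : lie A (a *: W) = a *: lie A W.
Proof. by rewrite /lie -scalemxAr -scalemxAl scalerDr. Qed.

(** By homogeneity Finsler's lemma extends from the unit sphere to a closed
    cone; the cones used below are linear subspaces. *)
Lemma finsler_cone (V : set 'cV[R]_n) M N :
  closed V -> (forall a x, V x -> V (a *: x)) ->
  (forall x, V x -> 0 <= qform M x) ->
  (forall x, V x -> x != 0 -> qform M x = 0 -> 0 < qform N x) ->
  exists2 e0, 0 < e0 & forall e, 0 < e -> e <= e0 ->
    forall x, V x -> x != 0 -> 0 < qform (M + e *: N) x.
Proof.
move=> cV sV M0 N0.
have [x [Vx _]|x [Vx /= x1]|e0 e00 h] := finsler (compact_sphereI cV)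
  (@qform_continuous M) (@qform_continuous N).
- exact: M0.
- by apply: N0 => //; rewrite -normr_eq0 x1 oner_eq0.
exists e0 => // e ep ee x Vx x0; have nx : 0 < `|x| by rewrite normr_gt0.
have : (V `&` [set x | `|x| = 1]) (`|x|^-1 *: x).
  by split; [exact: sV|rewrite /= normrZ normfV normr_id mulVf // gt_eqF].
move=> /(h e _ ep ee); rewrite -qform_mxZ -qform_mxD qformZ pmulr_rgt0 //.
by rewrite exprn_gt0 // invr_gt0.
Qed.

(** The kernel of the first [k] block rows of the observability matrix of
    [(A, S)]. *)
Definition unobservable A S k : set 'cV[R]_n :=
  \bigcap_(j in [set j | (j < k)%N]) [set x | S *m A ^+ j *m x = 0].

Lemma unobservable_closed A S k : closed (unobservable A S k).
Proof.
apply: closed_bigI => j _.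
rewrite (_ : [set _ | _] = (fun x => `|S *m A ^+ j *m x|) @^-1` [set 0 : R]).
  apply: preimage_closed; last exact: closed_eq.
  move=> x _; apply: continuous_comp; last exact: norm_continuous.
  exact: mulmx_continuous.
by apply/seteqP; split=> x /= => [->|/normr0_eq0]; rewrite ?normr0.
Qed.

(** The form [x^T P x] decreases at the rate [x^T S x], which vanishes on
    [unobservable A S 1].  There, the derivative of [N = (A^k)^T S A^(k+1)] is
    treated by descending induction on [k]: on [unobservable A S k.+1], where
    [S A^k x = 0], this derivative is [x^T (A^k.+1)^T S A^k.+1 x], hence nonnegative
    and zero only on [unobservable A S k.+2], where a strictly increasing form [W]
    is known.  Finsler's lemma makes [N + e W] strictly increasing on
    [unobservable A S k.+1].  The induction starts from the trivial subspace, by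
    observability, and ends with [P - e W]. *)
Lemma strict_lyapunov A S P :
  (forall x, x != 0 -> 0 < qform P x) ->
  (forall x, qform (lie A P) x = - qform S x) ->
  S^T = S -> (forall x, 0 <= qform S x) ->
  (forall x, qform S x = 0 -> S *m x = 0) ->
  (forall x, (forall j, (j < n)%N -> S *m A ^+ j *m x = 0) -> x = 0) ->
  exists W c, [/\ 0 < c, forall x, c * `|x| ^+ 2 <= qform W x &
    forall x, qform (lie A W) x <= - (c * `|x| ^+ 2)].
Proof.
move=> P0 PS ST S0 Sker obs.
have unobservableZ k a x : unobservable A S k x -> unobservable A S k (a *: x).
  by move=> xk j jk; rewrite /= -scalemxAr (xk j jk) scaler0.
have step d : forall k, (k.+1 + d)%N = n.+1 ->
    exists W, forall x, unobservable A S k.+1 x -> x != 0 -> 0 < qform (lie A W) x.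
  elim: d => [|d IHd] k.
    rewrite addn0 => -[->]; exists 0 => x xn; rewrite (obs x) ?eqxx // => j jn.
    by apply: xn; rewrite /= ltnS ltnW.
  rewrite addnS -addSn => /IHd[W W0].
  pose N := (A ^+ k)^T *m S *m A ^+ k *m A.
  have NE x : unobservable A S k.+1 x ->
      qform (lie A N) x = qform S (A ^+ k.+1 *m x).
    move=> xk; have Skx : (A ^+ k *m x)^T *m S = 0.
      by rewrite -[S in LHS]ST -trmx_mul mulmxA (xk k (ltnSn k)) trmx0.
    rewrite qform_lie [X in _ + X](_ : _ = 0) ?addr0.
      rewrite /qform /bform /N exprSr -mulmxE !trmx_mul.
      by rewrite !mulmxA.
    by rewrite /bform /N !mulmxA -trmx_mul Skx !mul0mx mxE.
  have [x xk|x xk x0|e e0 h] := finsler_cone (@unobservable_closed A S k.+1)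
    (unobservableZ k.+1) (M := lie A N) (N := lie A W).
  - by rewrite NE.
  - rewrite NE // => /Sker Sx; apply: W0 => // j; rewrite /= ltnS leq_eqVlt.
    by move=> /orP[/eqP ->|/xk //]; rewrite /= -mulmxA.
  exists (N + e *: W) => x xk x0; rewrite lieD lieZ; exact: h.
have [W W0] := step n 0%N (add1n n).
have [a x _|x _|x _ x0 /Sker Sx|e1 e10 h1] := @finsler_cone setT S (lie A W) closedT.
- by [].
- exact: S0.
- by apply: W0 => // j; rewrite /= ltnS leqn0 => /eqP ->; rewrite /= expr0 mulmx1.
have [a x _|x _|x _ x0|e2 e20 h2] := @finsler_cone setT P (- W) closedT.
- by [].
- have [->|x0] := eqVneq x 0; last exact/ltW/P0.
  by rewrite /qform /bform mulmx0 mxE.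
- by move/eqP; rewrite gt_eqF // P0.
pose e := Num.min e1 e2; have e0 : 0 < e by rewrite lt_min e10.
have [x x0|c1 c10 hc1] := @qform_coercive (P + e *: (- W)).
  by apply: h2 => //; rewrite ge_min lexx orbT.
have [x x0|c2 c20 hc2] := @qform_coercive (S + e *: lie A W).
  by apply: h1 => //; rewrite ge_min lexx.
exists (P + e *: (- W)), (Num.min c1 c2); split=> [|x|x].
- by rewrite lt_min c10.
- by apply: le_trans (hc1 x); rewrite ler_wpM2r ?exprn_ge0 // ge_min lexx.
have -> : qform (lie A (P + e *: - W)) x = - qform (S + e *: lie A W) x.
  by rewrite lieD lieZ -[- W]scaleN1r lieZ qform_mxD PS !qform_mxZ qform_mxD qform_mxZ; ring.
rewrite lerN2; apply: le_trans (hc2 x).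
by rewrite ler_wpM2r ?exprn_ge0 // ge_min lexx orbT.
Qed.

End QuadraticForms.

(** * Stability by a quadratic Lyapunov function *)

Section Lyapunov.
Context {R : realType} {n : nat}.
Variables (g : 'cV[R]_n -> 'cV[R]_n) (xf : 'cV[R]_n) (A W : 'M[R]_n) (c : R).
Hypothesis gA : has_jac g xf A.
Hypothesis gxf : g xf = 0.
Hypothesis c0 : 0 < c.
Hypothesis Wc : forall x, c * `|x| ^+ 2 <= qform W x.
Hypothesis lieW : forall x, qform (lie A W) x <= - (c * `|x| ^+ 2).

(* the summand [1] makes [C] a legitimate divisor *)
Let C : R := bform_bound W + 1.
Let C0 : 0 < C. Proof. by rewrite ltr_wpDl // bform_bound_ge0. Qed.
Let V x : R := qform W (x - xf).
Let a : R := c / 2 / C.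

Let bformC u v : `|bform W u v| <= C * `|u| * `|v|.
Proof.
apply: le_trans (ler_bform _ _ _) _.
by rewrite !ler_wpM2r // /C lerDl.
Qed.

Let VC x : V x <= C * `|x - xf| ^+ 2.
Proof. by rewrite expr2 mulrA; apply: le_trans (ler_norm _) (bformC _ _). Qed.

Let Vcont : continuous V.
Proof.
have sub_cont : continuous (fun x : 'cV[R]_n => x - xf).
  move=> x; apply: (cvg_normP (V := 'cV[R]_n) (W := 'cV[R]_n) _ x _).2 => e e0.
  by exists e => // z zx; rewrite opprB addrA subrK ltW.
move=> x; exact: (continuous_comp (sub_cont x) (@qform_continuous _ _ W _)).
Qed.

(** Along [g] the derivative of [V] is that along [A], at most [- c |x - xf|^2], up to
    [o(|x - xf|^2)].  Half of [c] pays for the error and the other half dominates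
    [a V]. *)
Lemma lyapunov_decrease : \forall x \near xf,
  bform W (g x) (x - xf) + bform W (x - xf) (g x) <= - (a * V x).
Proof.
have e0 : 0 < c / 4 / C by rewrite !divr_gt0.
have := gA e0; apply: filterS => x; rewrite gxf subr0 => hx.
set y := x - xf in hx *; set r := g x - A *m y in hx.
have -> : g x = A *m y + r by rewrite addrC subrK.
rewrite (bformDl W (A *m y) r y) (bformDr W y (A *m y) r) addrACA -qform_lie.
have h1 := lieW y; have /ler_normlP[_ h2] := bformC r y.
have /ler_normlP[_ h3] := bformC y r.
have h4 : C * `|r| * `|y| <= c / 4 * `|y| ^+ 2.
  apply: (@le_trans _ _ (C * (c / 4 / C * `|y|) * `|y|)).
    by rewrite ler_wpM2r // ler_pM2l.
  by rewrite le_eqVlt -subr_eq0; apply/orP; left; apply/eqP; field; rewrite gt_eqF.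
have h5 : a * V x <= c / 2 * `|y| ^+ 2.
  rewrite /a -mulrA ler_pM2l ?divr_gt0 // ler_pdivrMl //; exact: VC.
rewrite [C * `|y| * _]mulrAC in h3; lra.
Qed.

Lemma is_derive_qform (y : R -> 'cV[R]_n) (t : R) (v : 'cV[R]_n) : is_derive t 1 y v ->
  is_derive t 1 (fun s => V (y s)) (bform W v (y t - xf) + bform W (y t - xf) v).
Proof.
move=> /is_derive_normP dy; apply/is_derive_normP => e e0.
set z := y t - xf.
have K0 : 0 < C * (2 * `|z| + 1) + 1.
  by rewrite ltr_wpDl // mulr_ge0 // ?(ltW C0) // addr_ge0 // mulr_ge0.
pose e1 := Num.min 1 (e / 2 / (C * (2 * `|z| + 1) + 1)).
have e10 : 0 < e1 by rewrite lt_min ltr01 !divr_gt0.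
have [d d0 hd] := dy e1 e10.
have L0 : 0 < C * (1 + `|v|) ^+ 2.
  by rewrite mulr_gt0 // exprn_gt0 // ltr_wpDr.
exists (Num.min d (e / 2 / (C * (1 + `|v|) ^+ 2))).
  by rewrite lt_min d0 !divr_gt0.
move=> h; rewrite lt_min => /andP[hdl hL].
have := hd h hdl; set r := y (t + h) - y t - h *: v => hr.
have yE : y (t + h) - xf = z + (h *: v + r).
  by rewrite /r /z; apply/colP => i; rewrite !mxE; ring.
have dle : `|h *: v + r| <= (1 + `|v|) * `|h|.
  apply: le_trans (ler_normD _ _) _; rewrite normrZ mulrDl mul1r addrC.
  rewrite [`|h| * _]mulrC lerD // (le_trans hr) //.
  by rewrite ler_piMl // ge_min lexx.
have -> : V (y (t + h)) - V (y t) - h *: (bform W v z + bform W z v) =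
    bform W r z + bform W z r + bform W (h *: v + r) (h *: v + r).
  rewrite /V yE /qform -/z !(bformDl, bformDr, bformZl, bformZr).
  by rewrite /GRing.scale /=; ring.
apply: le_trans (ler_normD _ _) _; rewrite [e]splitr mulrDl lerD //.
  apply: (@le_trans _ _ (C * `|r| * `|z| + C * `|z| * `|r|)).
    by apply: le_trans (ler_normD _ _) _; rewrite lerD.
  have -> : C * `|r| * `|z| + C * `|z| * `|r| = C * (2 * `|z|) * `|r| by ring.
  apply: (@le_trans _ _ ((C * (2 * `|z| + 1) + 1) * (e1 * `|h|))).
    apply: ler_pM => //; first by rewrite !mulr_ge0 // ltW.
    by rewrite mulrDr mulr1 -addrA lerDl addr_ge0 // ltW.
  rewrite mulrA ler_wpM2r // mulrC -ler_pdivlMr //.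
  by rewrite ge_min lexx orbT.
apply: le_trans (bformC _ _) _.
apply: (@le_trans _ _ (C * ((1 + `|v|) * `|h|) * ((1 + `|v|) * `|h|))).
  by apply: ler_pM => //; rewrite ?mulr_ge0 ?(ltW C0) ?ler_pM2l //.
have -> : C * ((1 + `|v|) * `|h|) * ((1 + `|v|) * `|h|) =
   (C * (1 + `|v|) ^+ 2) * `|h| * `|h| by ring.
by rewrite ler_wpM2r // mulrC -ler_pdivlMr // ltW.
Qed.

Variable rho : R.
Hypothesis Vrho : forall x, `|x - xf| < rho ->
  bform W (g x) (x - xf) + bform W (x - xf) (g x) <= - (a * V x).

(** Gronwall's inequality: [V (y t) exp (a t)] has nonpositive derivative. *)
Lemma lyapunov_decay (y : R -> 'cV[R]_n) (b : R) : 0 <= b ->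
  {within `[0, b], continuous y} ->
  (forall t, 0 < t -> t < b -> `|y t - xf| < rho /\ is_derive t 1 y (g (y t))) ->
  V (y b) * expR (a * b) <= V (y 0).
Proof.
move=> b0 cy dy.
pose phi t := V (y t) * expR (a * t).
have dphi t : t \in `]0, b[ -> is_derive t 1 phi
    ((bform W (g (y t)) (y t - xf) + bform W (y t - xf) (g (y t)) + a * V (y t))
      * expR (a * t)).
  rewrite in_itv /= => /andP[t0 tb]; have [_ /is_derive_qform dV] := dy t t0 tb.
  have de : is_derive t 1 (fun s => expR (a * s)) (a * expR (a * t)).
    have -> : (fun s => expR (a * s)) = expR \o (fun s : R => a *: s) by [].
    rewrite mulrC; apply: (@is_derive1_comp R expR).
    have := @is_deriveZ R R R id a t 1 1 (is_derive_id _ _).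
    by move/is_derive_eq; apply; rewrite /GRing.scale /= mulr1.
  apply: is_derive_eq (is_deriveM dV de) _.
  by rewrite /GRing.scale /=; ring.
suff : phi b <= phi 0 by rewrite /phi mulr0 expR0 mulr1.
apply: (@ler0_derive1_le_cc R phi 0 b).
- by move=> t /dphi[].
- move=> t tb; rewrite derive1E; have [_ ->] := dphi t tb.
  move: tb; rewrite in_itv /= => /andP[t0 tb]; have [/Vrho yt _] := dy t t0 tb.
  by rewrite mulr_le0_ge0 ?expR_ge0 //; move: yt; lra.
- move=> t; apply: cvgM.
    apply: (continuous_comp (g := V)); first exact: cy.
    exact: Vcont.
  have /continuous_subspaceT : continuous (fun s => expR (a * s)); last exact.
  move=> s; apply: continuous_comp; last exact: continuous_expR.
  by apply: cvgM; [exact: cvg_cst|exact: cvg_id].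
- by rewrite in_itv /= lexx b0.
- by rewrite in_itv /= lexx b0.
- by [].
Qed.

(** A solution that reached distance [eps] would do so for a first time [s]; up to
    [s] it stays where [V] decreases, so that
    [c eps^2 <= V (y s) <= V (y 0) <= C |y 0 - xf|^2], which fails for a close
    initial state.  The equation is required of [y] only within distance [rho], so
    that the statement also covers solutions of a field modified elsewhere. *)
Lemma lyapunov_trap (eps : R) : 0 < eps -> eps <= rho ->
  exists2 delta, 0 < delta & forall (y : R -> 'cV[R]_n) (b : R),
    {within `[0, b], continuous y} ->
    (forall t, 0 < t -> t < b -> `|y t - xf| < rho -> is_derive t 1 y (g (y t))) ->
    `|y 0 - xf| < delta -> forall t, 0 <= t -> t <= b -> `|y t - xf| < eps.
Proof.
move=> eps0 epsrho.
(* [k <= 1] gives [k ^ 2 <= k], so that [C k < c] suffices for [C k ^ 2 < c] *)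
pose k := Num.min 1 (c / (C + 1)).
have k0 : 0 < k by rewrite lt_min ltr01 divr_gt0 // addr_gt0.
have kC : C * k < c.
  apply: (@le_lt_trans _ _ (C * (c / (C + 1)))).
    by rewrite ler_pM2l // ge_min lexx orbT.
  have C1 : 0 < C + 1 by rewrite addr_gt0.
  by rewrite mulrCA gtr_pMr // ltr_pdivrMr // mul1r ltrDl.
exists (k * eps); first by rewrite mulr_gt0.
move=> y b cy dy y0 t t0 tb; rewrite ltNge; apply/negP => yt.
pose S := [set s : R | 0 <= s <= t /\ eps <= `|y s - xf|].
have St : S t by rewrite /S /= t0 lexx.
have S0 : lbound S 0 by move=> s [/andP[]].
have hS : has_inf S by split; [exists t|exists 0].
set s := inf S.
have s0 : 0 <= s by apply: lb_le_inf => //; exists t.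
have st : s <= t by apply: ge_inf => //; exists 0.
have below u : 0 <= u -> u < s -> `|y u - xf| < eps.
  move=> u0 us; rewrite ltNge; apply/negP => yu.
  suff : s <= u by rewrite leNgt us.
  apply: ge_inf; first by exists 0.
  by split=> //; rewrite u0 /= (le_trans (ltW us)).
have /within_continuousP cy' := cy.
(* the infimum of the exit times is itself an exit time, by continuity *)
have ys : eps <= `|y s - xf|.
  rewrite leNgt; apply/negP => ys.
  have e0 : 0 < (eps - `|y s - xf|) / 2 by rewrite divr_gt0 // subr_gt0.
  have sb : `[0, b]%classic s by rewrite /= in_itv /= s0 (le_trans st).
  have [d d0 hd] := cy' s sb _ e0.
  have [u [/andP[u0 ut] yu] us] := inf_adherent d0 hS.
  have su : s <= u by apply: ge_inf; [exists 0|rewrite /S /= u0 ut].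
  have := hd u; rewrite /= in_itv /= u0 (le_trans ut) // => /(_ isT).
  rewrite ger0_norm ?subr_ge0 // ltrBlDl => /(_ us) yus.
  have := ler_normD (y u - y s) (y s - xf); rewrite addrA subrK => h.
  move: yus yu ys h; set p := `|y u - xf|; set q := `|y s - xf|; lra.
have sub : `[0, s]%classic `<=` `[0, b]%classic.
  move=> u; rewrite /= !in_itv /= => /andP[-> us] /=.
  exact: le_trans us (le_trans st tb).
have cys := continuous_subspaceW sub cy.
have y0n : C * `|y 0 - xf| ^+ 2 < c * eps ^+ 2.
  apply: (@le_lt_trans _ _ (C * k * eps ^+ 2)); last first.
    by rewrite ltr_pM2r // exprn_gt0.
  rewrite -mulrA ler_pM2l //; apply: (@le_trans _ _ ((k * eps) ^+ 2)).
    by rewrite lerXn2r ?nnegrE ?(ltW y0) ?mulr_ge0 // ltW.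
  rewrite exprMn ler_wpM2r //; first by rewrite exprn_ge0 // ltW.
  by rewrite expr2 ler_piMr ?(ltW k0) // ge_min lexx.
have Vs : c * eps ^+ 2 <= V (y s) * expR (a * s).
  apply: (@le_trans _ _ (V (y s))).
    apply: le_trans (Wc _); rewrite ler_pM2l //.
    by rewrite lerXn2r ?nnegrE ?(ltW eps0).
  apply: ler_peMr.
    by apply: le_trans (Wc _); rewrite mulr_ge0 ?(ltW c0) // exprn_ge0.
  by rewrite -expR0 ler_expR mulr_ge0 // /a !divr_ge0 // ltW.
have hy u : 0 < u -> u < s ->
    `|y u - xf| < rho /\ is_derive u 1 y (g (y u)).
  move=> u0 us; have yu := lt_le_trans (below u (ltW u0) us) epsrho.
  split=> //; apply: dy => //; exact: lt_le_trans us (le_trans st tb).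
have := lyapunov_decay s0 cys hy; have := VC (y 0); lra.
Qed.

Hypothesis rho0 : 0 < rho.
Hypothesis g_cont : forall x, `|x - xf| < rho -> {for x, continuous g}.
Hypothesis g_bnd : exists M, forall x, `|x - xf| < rho -> `|g x| <= M.

Lemma solution_segment T x0 y b : is_solution g T x0 y -> (b%:E < T)%E ->
  {within `[0, b], continuous y} /\
  (forall t, 0 < t -> t < b -> is_derive t 1 y (g (y t))).
Proof.
move=> [_ cy dy] bT; split.
  apply: continuous_subspaceW cy => t; rewrite /= in_itv /= => /andP[-> tb].
  by split=> //; apply: le_lt_trans bT; rewrite lee_fin.
move=> t t0 tb; apply: dy => //; apply: lt_trans bT; by rewrite lte_fin.
Qed.

(** Cut off outside the ball of radius [rho], the field is bounded and has global
    solutions; those that start close to [xf] never see the cut. *)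
Lemma lyapunov_existence (eps : R) : 0 < eps -> eps <= rho ->
  exists2 delta, 0 < delta & forall x0, `|x0 - xf| < delta ->
    exists y, is_solution g +oo%E x0 y.
Proof.
move=> e0 er; have [delta d0 trap] := lyapunov_trap e0 er.
exists delta => // x0 x0d; have [M gM] := g_bnd.
pose gt x := if `|x - xf| < rho then g x else 0.
have gtM x : `|gt x| <= Num.max M 0.
  by rewrite /gt; case: ifPn => [/gM h|_]; rewrite ?normr0 le_max ?h ?lexx ?orbT.
have [y [y0 ylip dy]] := peano_bounded gtM x0.
have cy : {within [set t : R | 0 <= t], continuous y}.
  apply/within_continuousP => s s0 e e1.
  have M1 : 0 < Num.max M 0 + 1 by rewrite ltr_wpDl // le_max lexx orbT.
  exists (e / (Num.max M 0 + 1)); first by rewrite divr_gt0.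
  move=> t t0; rewrite ltr_pdivlMr // => ts.
  apply: (@le_trans _ _ (`|t - s| * Num.max M 0)).
    have [st|/ltW ts'] := leP s t; first by rewrite ger0_norm ?subr_ge0 // ylip.
    by rewrite distrC (distrC t) ger0_norm ?subr_ge0 // ylip.
  apply: ltW; apply: le_lt_trans ts; by rewrite ler_wpM2l // lerDl.
have dyg t : 0 < t -> `|y t - xf| < rho -> is_derive t 1 y (g (y t)).
  move=> t0 yr; have gtE : gt (y t) = g (y t) by rewrite /gt yr.
  rewrite -gtE; apply: dy => //.
  have near_gt : \forall x \near y t, g x = gt x.
    apply: (near_normP (y t) _).2; exists (rho - `|y t - xf|); first by rewrite subr_gt0.
    move=> x xy; rewrite /gt ifT //.
    rewrite -[x](subrK (y t)) -addrA; apply: le_lt_trans (ler_normD _ _) _.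
    by rewrite -ltrBrDr.
  have gc : g x @[x --> y t] --> g (y t) := g_cont yr.
  rewrite /prop_for /continuous_at gtE.
  apply: cvg_trans gc; apply: (near_eq_cvg near_gt).
have yr t : 0 <= t -> `|y t - xf| < eps.
  move=> t0; apply: (trap y t) => //.
  - apply: continuous_subspaceW cy => s; by rewrite /= in_itv /= => /andP[].
  - by move=> s s0 _; exact: dyg.
  - by rewrite y0.
exists y; split=> //.
  by apply: continuous_subspaceW cy => s [].
by move=> t t0 _; apply: dyg => //; apply: lt_le_trans er; exact/yr/ltW.
Qed.

Lemma lyapunov_asymp_stable : loc_asymp_stable_equilibrium g xf.
Proof.
split=> // [eps eps0|].
  have e0 : 0 < Num.min eps rho by rewrite lt_min eps0.
  have er : Num.min eps rho <= rho by rewrite ge_min lexx orbT.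
  have [d1 d10 h1] := lyapunov_existence e0 er.
  have [d2 d20 h2] := lyapunov_trap e0 er.
  exists (Num.min d1 d2); first by rewrite lt_min d10.
  move=> x0; rewrite lt_min => /andP[x1 x2]; split; first exact: h1.
  move=> T y soly t t0 tT; have [cy dy] := solution_segment soly tT.
  have [y0 _ _] := soly.
  have := h2 y t cy (fun s s0 st _ => dy s s0 st); rewrite y0.
  by move=> /(_ x2 t t0 (lexx t)); rewrite lt_min => /andP[].
have [d d0 trap] := lyapunov_trap rho0 (lexx rho).
exists d => // x0 x0d y soly; have [y0 _ _] := soly.
have a0 : 0 < a by rewrite !divr_gt0.
have V0 : 0 <= V x0 by apply: le_trans (Wc _); rewrite mulr_ge0 ?(ltW c0) // exprn_ge0.
apply/cvgrPdist_le => e e0.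
have ce : 0 < c * e ^+ 2 by rewrite mulr_gt0 // exprn_gt0.
exists (Num.max 0 (V x0 / (c * e ^+ 2) / a)); split; first exact: num_real.
move=> t; rewrite gt_max => /andP[t0 tV]; rewrite distrC.
have [cy dy] := solution_segment (b := t) soly (ltry t).
have hy u : 0 < u -> u < t ->
    `|y u - xf| < rho /\ is_derive u 1 y (g (y u)).
  move=> u0 ut; split; last exact: dy.
  apply: (trap y t) => //; rewrite ?y0 // ?ltW // => s s0 st _; exact: dy.
have := lyapunov_decay (ltW t0) cy hy; rewrite y0 => h.
have h1 : c * `|y t - xf| ^+ 2 * (1 + a * t) <= V x0.
  apply: le_trans h; apply: ler_pM.
  - by rewrite mulr_ge0 ?(ltW c0) // exprn_ge0.
  - by rewrite addr_ge0 // mulr_ge0 ?ltW.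
  - exact: Wc.
  - exact: expR_ge1Dx.
(* [exp (a t) >= 1 + a t] already forces [V] to [0] *)
rewrite -(ler_pXn2r (n := 2)) ?nnegrE ?(ltW e0) // -(ler_pM2l c0).
have at0 : 0 < 1 + a * t by rewrite addr_gt0 // mulr_gt0.
rewrite -(ler_pM2r at0); apply: le_trans h1 _.
move: tV; rewrite !ltr_pdivrMr // => tV.
apply: ltW; apply: lt_trans tV _.
by rewrite [ltRHS]mulrC ltr_pM2r // [a * t]mulrC ltrDr.
Qed.

End Lyapunov.

(** Lyapunov's indirect method for a field that is merely continuous. *)
Lemma linearized_stability (R : realType) n (g : 'cV[R]_n -> 'cV[R]_n) xf
    (A W : 'M[R]_n) (c : R) :
  has_jac g xf A -> g xf = 0 -> continuous g -> 0 < c ->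
  (forall x, c * `|x| ^+ 2 <= qform W x) ->
  (forall x, qform (lie A W) x <= - (c * `|x| ^+ 2)) ->
  loc_asymp_stable_equilibrium g xf.
Proof.
move=> gA gxf g_cont c0 Wc lieW.
have /near_normP[rho1 rho10 h1] := lyapunov_decrease gA gxf c0 lieW.
have /near_normP[rho2 rho20 h2] := has_jac_lip gA.
have rho0 : 0 < Num.min rho1 rho2 by rewrite lt_min rho10.
apply: (lyapunov_asymp_stable gxf c0 Wc (rho := Num.min rho1 rho2)) => //.
- by move=> x; rewrite lt_min => /andP[xr _]; exact: h1.
- by move=> x _; exact: g_cont.
- exists ((n%:R * `|A| + 1) * rho2) => x; rewrite lt_min => /andP[_ xr].
  have := h2 x xr; rewrite gxf subr0 => /le_trans; apply.
  by rewrite ler_wpM2l ?addr_ge0 ?mulr_ge0 // ltW.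
Qed.

(** * Networks and their corrections *)

Section Networks.
Context {R : realType}.

Lemma has_jac_id n (a : 'cV[R]_n) : has_jac id a 1%:M.
Proof.
apply: eq_has_jac (has_jac_affine 1%:M 0 0 a).
by move=> x; rewrite mul1mx subr0 addr0.
Qed.

Lemma has_jac_mulmx n k (M : 'M[R]_(k, n)) (a : 'cV[R]_n) :
  has_jac (mulmx M) a M.
Proof.
by apply: eq_has_jac (has_jac_affine M 0 0 a) => x; rewrite subr0 addr0.
Qed.

Lemma has_jac_cst n k (b : 'cV[R]_k) (a : 'cV[R]_n) : has_jac (fun=> b) a 0.
Proof.
apply: eq_has_jac (has_jac_affine 0 0 b a).
by move=> x; rewrite mul0mx add0r.
Qed.

Lemma has_jac_map n (s : 'I_n -> R -> R) (ds : 'I_n -> R) (a : 'cV[R]_n) :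
  (forall i, is_derive (a i 0) 1 (s i) (ds i)) ->
  has_jac (fun x : 'cV[R]_n => \col_i s i (x i 0)) a (diag_mx (\row_i ds i)).
Proof.
move=> hs; apply: has_jac_coord => i e e0; rewrite !mxE.
have /is_derive_normP/(_ e e0)[d d0 hd] := hs i.
apply: (near_normP a _).2; exists d => // x xd; rewrite mxE.
have xi : `|x i 0 - a i 0| <= `|x - a|.
  by have := ler_mx_coord (x - a) i 0; rewrite !mxE.
have := hd (x i 0 - a i 0) (le_lt_trans xi xd).
rewrite [a i 0 + _]addrC subrK => h; apply: le_trans (ler_wpM2l (ltW e0) xi).
apply: le_trans h; rewrite le_eqVlt; apply/orP; left; apply/eqP.
congr (`|_ - _|); rewrite (bigD1 i) //= !mxE eqxx mulr1n big1 ?addr0.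
  by rewrite mulrC.
by move=> j ji; rewrite !mxE eq_sym (negbTE ji) mulr0n mul0r.
Qed.

Lemma feedforward_has_jac n k (F : 'cV[R]_n -> 'cV[R]_k) :
  feedforward F -> forall a, exists M, has_jac F a M.
Proof.
elim=> {n k F} [n k M b|n s hs|n h k G F _ IHG _ IHF] a.
- exists M; apply: eq_has_jac (has_jac_affine M 0 b a).
  by move=> x; rewrite subr0.
- exists (diag_mx (\row_i 'D_1 (s i) (a i 0))); apply: has_jac_map => i.
  exact/derivableP/(hs i).1.
- have [M FM] := IHF a; have [N GN] := IHG (F a).
  by exists (N *m M); exact: has_jac_comp.
Qed.

Lemma feedforward_jac n k (F : 'cV[R]_n -> 'cV[R]_k) a :
  feedforward F -> has_jac F a (Jac F a).
Proof. by move=> /feedforward_has_jac/(_ a)[M /[dup] /has_jacP[_ ->]]. Qed.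

Lemma feedforward_continuous n k (F : 'cV[R]_n -> 'cV[R]_k) :
  feedforward F -> continuous F.
Proof. by move=> /feedforward_has_jac ff a; have [M /has_jac_cvg] := ff a. Qed.

Lemma reshape_continuous n k l (F : 'cV[R]_n -> 'cV[R]_(k * l)) :
  continuous F -> continuous (fun x => reshape_mx (F x)).
Proof.
move=> cF a; apply: (cvg_normP (V := 'cV[R]_n) (W := 'M[R]_(k, l)) _ a _).2 => e e0.
have /(cvg_normP (V := 'cV[R]_n) (W := 'cV[R]_(k * l)))/(_ e e0)[d d0 hd] := cF a.
exists d => // x xd; apply/mx_norm_leP; first exact: ltW.
move=> i j; rewrite !mxE; apply: le_trans (hd x xd).
by have := ler_mx_coord (F x - F a) (mxvec_index i j) 0; rewrite !mxE.
Qed.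

(** Since [G x - G a] tends to [0], the product is [o(x - a)]. *)
Lemma has_jac_small_mul n k (G : 'cV[R]_n -> 'M[R]_(k, n)) a :
  {for a, continuous G} -> has_jac (fun x => (G x - G a) *m (x - a)) a 0.
Proof.
move=> cG e e0.
have Ga : G x @[x --> a] --> G a by [].
have n0 : 0 < n%:R + 1 :> R by rewrite ltr_wpDl.
have e1 : 0 < e / (n%:R + 1) by rewrite divr_gt0.
have /(cvg_normP (V := 'cV[R]_n) (W := 'M[R]_(k, n)))/(_ _ e1)[d d0 hd] := Ga.
apply: (near_normP a _).2; exists d => // x xd.
rewrite !subrr !mul0mx !subr0.
apply: le_trans (ler_norm_mulmx _ _) _; rewrite ler_wpM2r //.
apply: (@le_trans _ _ ((n%:R + 1) * (e / (n%:R + 1)))).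
  by apply: ler_pM => //; [rewrite lerDl|exact: hd].
by rewrite mulrCA divff ?mulr1 // gt_eqF.
Qed.

End Networks.

(** * Gradients relative to a set *)

Section Gradient.
Context {R : realType} {k : nat}.
Implicit Types (D : set 'cV[R]_k) (g : 'cV[R]_k -> R).

Lemma has_gradient_onP D g dg a : has_gradient_on D g dg -> D a ->
  forall e, 0 < e -> exists2 d, 0 < d & forall z, D z -> `|z - a| < d ->
    `|g z - g a - \sum_(i < k) dg i a * (z i 0 - a i 0)| <= e * `|z - a|.
Proof.
move=> hg Da e e0; have := hg a Da; move=> /cvgrPdist_le/(_ e e0).
move=> /(near_normP a)[d d0 hd]; exists d => // z Dz zd.
have [->|za] := eqVneq z a.
  rewrite !subrr normr0 mulr0 sub0r normrN big1 ?normr0 // => i _.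
  by rewrite subrr mulr0.
have := hd z zd za Dz; rewrite sub0r normrN normrM normfV normr_id.
by rewrite ler_pdivrMr ?normr_gt0 // subr_eq0.
Qed.

Lemma gradient_continuous D g dg : has_gradient_on D g dg ->
  {within D, continuous g}.
Proof.
move=> hg; apply/within_continuousP => a Da e e0.
have [d d0 hd] := has_gradient_onP hg Da ltr01.
pose L := \sum_(i < k) `|dg i a| + 1.
have L0 : 0 < L by rewrite ltr_wpDl // sumr_ge0.
exists (Num.min d (e / L)); first by rewrite lt_min d0 divr_gt0.
move=> x Dx; rewrite lt_min => /andP[xd xe].
have h := hd x Dx xd.
rewrite -[g x - g a](subrK (\sum_(i < k) dg i a * (x i 0 - a i 0))).
apply: le_trans (ler_normD _ _) _; apply: (@le_trans _ _ (L * `|x - a|)); last first.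
  by rewrite mulrC -ler_pdivlMr // ltW.
rewrite /L mulrDl addrC lerD // mulr_suml; apply: le_trans (ler_norm_sum _ _ _) _.
apply: ler_sum => i _; rewrite normrM ler_wpM2l //.
by have := ler_mx_coord (x - a) i 0; rewrite !mxE.
Qed.

Lemma gradient_is_derive D g dg a j : has_gradient_on D g dg ->
  interior D a -> is_derive a (delta_mx j 0) g (dg j a).
Proof.
move=> hg aD; apply/is_derive_dirP => e e0; have Da := interior_subset aD.
have /near_normP[d1 d10 hD] := aD.
have [d2 d20 hd] := has_gradient_onP hg Da e0.
exists (Num.min d1 d2); first by rewrite lt_min d10.
move=> h; rewrite lt_min => /andP[h1 h2].
have nh : `|a + h *: delta_mx j 0 - a| = `|h|.
  by rewrite addrAC subrr add0r normrZ norm_delta_mx mulr1.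
have := hd (a + h *: delta_mx j 0); rewrite nh => /(_ _ h2).
rewrite (bigD1 j) //= big1 => [|i ij]; last first.
  by rewrite !mxE (negbTE ij) mulr0 addr0 subrr mulr0.
rewrite !mxE !eqxx mulr1 addr0 [a j 0 + h]addrC addrK [dg j a * h]mulrC.
by apply; apply: hD; rewrite nh.
Qed.

Lemma gradient_has_jac l (D : set 'cV[R]_k) (g : 'I_l -> 'cV[R]_k -> R)
    (dg : 'I_l -> 'I_k -> 'cV[R]_k -> R) a :
  (forall i, has_gradient_on D (g i) (dg i)) -> interior D a ->
  has_jac (fun z => \col_i g i z) a (\matrix_(i, j) dg i j a).
Proof.
move=> hg aD; apply: has_jac_coord => i e e0; have Da := interior_subset aD.
have /near_normP[d1 d10 hD] := aD.
have [d2 d20 hd] := has_gradient_onP (hg i) Da e0.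
apply: (near_normP a _).2; exists (Num.min d1 d2); first by rewrite lt_min d10.
move=> z; rewrite lt_min => /andP[z1 z2]; have := hd z (hD z z1) z2; rewrite !mxE.
by congr (`|_ - _| <= _); apply: eq_bigr => j _; rewrite mxE.
Qed.

(** Fermat's rule, for a scalar function written with values in [1 x 1] matrices so
    that the calculus of [has_jac] applies to it. *)
Lemma has_jac_local_min (G : 'cV[R]_k -> 'cV[R]_1) a M : has_jac G a M ->
  (\forall z \near a, G a 0 0 <= G z 0 0) -> M = 0.
Proof.
move=> GM /near_normP[d1 d10 Gmin]; apply/matrixP => i0 i; rewrite mxE (ord1 i0).
set c := M 0 i; apply/eqP/negPn/negP => c_neq0.
have c0 : 0 < `|c| by rewrite normr_gt0.
have c2 : 0 < `|c| / 2 by rewrite divr_gt0.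
have /near_normP[d2 d20 hd] := GM _ c2.
(* a small step against the gradient *)
pose t := Num.min d1 d2 / 2 / `|c|.
have t0 : 0 < t by rewrite !divr_gt0 // lt_min d10.
pose z := a - (t * c) *: delta_mx i 0.
have za : z - a = - (t * c) *: delta_mx i 0.
  by rewrite /z addrAC subrr add0r scaleNr.
have nz : `|z - a| = t * `|c|.
  by rewrite za normrZ norm_delta_mx mulr1 normrN normrM gtr0_norm.
have zd : `|z - a| < Num.min d1 d2.
  by rewrite nz /t divfK ?gt_eqF // ltr_pdivrMr // ltr_pMr ?ltr1n // lt_min d10.
move: zd; rewrite lt_min => /andP[zd1 zd2].
have := le_trans (ler_mx_coord _ 0 0) (hd z zd2); rewrite nz za.
rewrite -scalemxAr -colE !mxE -/c => /ler_normlP[_ h].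
have cc : c * c = `|c| * `|c| by rewrite -normrM ger0_norm // -expr2 sqr_ge0.
have tcc : 0 < t * (`|c| * `|c|) := mulr_gt0 t0 (mulr_gt0 c0 c0).
have gz := Gmin z zd1.
have h2 : - (t * c) * c = - (t * (`|c| * `|c|)) by rewrite -cc; ring.
have h3 : `|c| / 2 * (t * `|c|) = t * (`|c| * `|c|) / 2 by ring.
move: h; rewrite h2 h3; lra.
Qed.

End Gradient.

(** * Continuous dependence of a unique minimizer *)

Section Argmin.
Context {R : realType} {V : normedModType R} {m : nat}.

(** Berge's theorem for a single-valued minimizer: values [u x] with [x] close to
    [x0] but [u x] far from [u x0] would accumulate, by compactness of the box, at a
    second minimizer for [x0]. *)
Lemma argmin_continuous (lo hi : 'cV[R]_m) (H : V -> 'cV[R]_m -> R)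
    (u : V -> 'cV[R]_m) (x0 : V) :
  (forall v, box lo hi v -> forall e, 0 < e -> exists2 d, 0 < d &
     forall x w, box lo hi w -> `|x - x0| < d -> `|w - v| < d ->
       `|H x w - H x0 v| <= e) ->
  (forall x, argmin (box lo hi) (H x) = [set u x]) ->
  u x @[x --> x0] --> u x0.
Proof.
move=> cH uP.
have uU x : box lo hi (u x).
  by have [] : argmin (box lo hi) (H x) (u x) by rewrite uP.
have umin x v : box lo hi v -> H x (u x) <= H x v.
  by move: v; have [] : argmin (box lo hi) (H x) (u x) by rewrite uP.
apply: (cvg_normP (W := 'cV[R]_m) u x0 _).2 => e e0.
apply: contrapT => nue.
(* the filter of those values [u x], [x] close to [x0], that stay far from [u x0] *)
pose F : set_system 'cV[R]_m :=
  [set B | \forall x \near x0, e <= `|u x0 - u x| -> B (u x)].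
have FF : ProperFilter F.
  apply: Build_ProperFilter_ex => [B FB|].
    apply: contrapT => nB; apply: nue; have /near_normP[d d0 hd] := FB.
    exists d => // x xd; rewrite leNgt; apply/negP; rewrite distrC => /ltW ue.
    by apply: nB; exists (u x); exact: hd ue.
  split; rewrite /F /=; first by apply: nearW.
    by move=> B1 B2 /= F1 F2; apply: filterS2 F1 F2 => x h1 h2 xe; split; auto.
  by move=> B1 B2 sB /=; apply: filterS => x h1 /h1 /sB.
have [|v [Uv Fv]] := @box_compact _ _ lo hi F FF; first by rewrite /F /=; apply: nearW.
have nbhs_v (d : R) : 0 < d -> \forall z \near v, `|z - v| < d.
  by move=> d0; apply: (near_normP (V := 'cV[R]_m) v (fun z => `|z - v| < d)).2; exists d.
have [vu|vu] := eqVneq v (u x0).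
  have [||z [/= ze]] := Fv [set z | e <= `|u x0 - z|] [set z | `|z - v| < e].
  - by rewrite /F /=; apply: nearW.
  - exact: nbhs_v.
  by rewrite /= vu distrC ltNge ze.
have [w [Uw Hw]] : exists w, box lo hi w /\ H x0 w < H x0 v.
  apply: contrapT => nw; move/eqP: vu; apply.
  suff : argmin (box lo hi) (H x0) v by rewrite uP.
  split=> // w Uw; rewrite leNgt; apply/negP => Hw; apply: nw; by exists w.
have eta0 : 0 < (H x0 v - H x0 w) / 3 by rewrite divr_gt0 // subr_gt0.
have [d1 d10 h1] := cH v Uv _ eta0; have [d2 d20 h2] := cH w Uw _ eta0.
have d0 : 0 < Num.min d1 d2 by rewrite lt_min d10.
have [||z [[x [xd zE]]]] :=
  Fv [set z | exists x, `|x - x0| < Num.min d1 d2 /\ z = u x] [set z | `|z - v| < d1].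
- by apply: (near_normP x0 _).2; exists (Num.min d1 d2) => // x xd _; exists x.
- exact: nbhs_v.
rewrite /= zE => zv.
move: xd; rewrite lt_min => /andP[xd1 xd2].
have := h1 x (u x) (uU x) xd1 zv; have := h2 x w Uw xd2; rewrite subrr normr0.
move=> /(_ d20) /ler_normlP[_ k2] /ler_normlP[k1 _].
have := umin x w Uw.
have eq3 : H x0 v - H x0 w = (H x0 v - H x0 w) / 3 * 3 by field.
move: eq3 k1 k2 eta0; set eta := (H x0 v - _) / 3; lra.
Qed.

End Argmin.

(** * The Hamiltonian minimizer *)

Section Feedback.
Context {R : realType} {n m : nat}.
Implicit Types (x : 'cV[R]_n) (u : 'cV[R]_m).

(** [C1_field] differentiates the dynamics as a function of the stacked column. *)
Definition joint (f : 'cV[R]_n -> 'cV[R]_m -> 'cV[R]_n) (z : 'cV[R]_(n + m)) :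
  'cV[R]_n := f (usubmx z) (dsubmx z).

Lemma norm_dsubmx (z : 'cV[R]_(n + m)) : `|dsubmx z| <= `|z|.
Proof. by apply/mx_norm_leP => // i j; rewrite !mxE ler_mx_coord. Qed.

Lemma interior_joint (U : set 'cV[R]_m) x u : interior U u ->
  interior [set z : 'cV[R]_(n + m) | U (dsubmx z)] (col_mx x u).
Proof.
move=> /(near_normP u)[d d0 hd].
apply: (near_normP (V := 'cV[R]_(n + m)) (col_mx x u) _).2; exists d => // z zd.
apply: hd; apply: le_lt_trans zd.
rewrite -[u in dsubmx z - u](col_mxKd x u) -linearB /=; exact: norm_dsubmx.
Qed.

Lemma joint_has_jac (U : set 'cV[R]_m) (f : 'cV[R]_n -> 'cV[R]_m -> 'cV[R]_n)
    df x u :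
  (forall i, has_gradient_on [set z : 'cV[R]_(n + m) | U (dsubmx z)]
     (fun z => f (usubmx z) (dsubmx z) i 0) (df i)) ->
  interior U u ->
  has_jac (joint f) (col_mx x u) (\matrix_(i, j) df i j (col_mx x u)).
Proof.
move=> hf uU; have := gradient_has_jac hf (interior_joint x uU).
apply: eq_has_jac => z; by apply/colP => i; rewrite mxE.
Qed.

Lemma partial_has_jac (f : 'cV[R]_n -> 'cV[R]_m -> 'cV[R]_n) x u M :
  has_jac (joint f) (col_mx x u) M ->
  has_jac (fun z => f z u) x (lsubmx M) /\ has_jac (f x) u (rsubmx M).
Proof.
move=> hM; split.
  have := has_jac_comp (has_jac_col_mx (has_jac_id x) (has_jac_cst u x)) hM.
  rewrite -[M in M *m _]hsubmxK mul_row_col mulmx1 mulmx0 addr0.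
  apply: eq_has_jac => z.
  by rewrite /joint /= col_mxKu col_mxKd.
have := has_jac_comp (has_jac_col_mx (has_jac_cst x u) (has_jac_id u)) hM.
rewrite -[M in M *m _]hsubmxK mul_row_col mulmx1 mulmx0 add0r.
apply: eq_has_jac => z.
by rewrite /joint /= col_mxKu col_mxKd.
Qed.

Lemma norm_col_mx_lt x u x0 u0 (d : R) : `|x - x0| < d -> `|u - u0| < d ->
  `|col_mx x u - col_mx x0 u0| < d.
Proof.
move=> xd ud; rewrite opp_col_mx add_col_mx.
apply: (@le_lt_trans _ _ (Num.max `|x - x0| `|u - u0|)); last by rewrite gt_max xd.
by apply: norm_le_col_mx; rewrite le_max lexx ?orbT.
Qed.

(** Stated for any [F] so that it serves both the dynamics and its partial
    derivatives. *)
Lemma joint_cvg (U : set 'cV[R]_m) (W : normedModType R)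
    (F : 'cV[R]_(n + m) -> W) (u : 'cV[R]_n -> 'cV[R]_m) x0 :
  {within [set z : 'cV[R]_(n + m) | U (dsubmx z)], continuous F} ->
  (forall x, U (u x)) -> u x @[x --> x0] --> u x0 ->
  F (col_mx x (u x)) @[x --> x0] --> F (col_mx x0 (u x0)).
Proof.
move=> /within_continuousP cF uU cu.
apply: (cvg_normP (V := 'cV[R]_n) _ x0 _).2 => e e0.
have DU x : U (dsubmx (col_mx x (u x))) by rewrite col_mxKd.
have [d d0 hd] := cF _ (DU x0) e e0.
have d2 : 0 < d / 2 by rewrite divr_gt0.
have [d1 d10 h1] := (cvg_normP (V := 'cV[R]_n) (W := 'cV[R]_m) u x0 _).1 cu _ d2.
exists (Num.min d d1); first by rewrite lt_min d0.
move=> x; rewrite lt_min => /andP[xd xd1]; apply: hd; first exact: DU.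
apply: norm_col_mx_lt => //; apply: le_lt_trans (h1 x xd1) _.
by rewrite ltr_pdivrMr // ltr_pMr // ltr1n.
Qed.

Lemma joint_continuous (U : set 'cV[R]_m) (f : 'cV[R]_n -> 'cV[R]_m -> 'cV[R]_n) :
  C1_field U f ->
  {within [set z : 'cV[R]_(n + m) | U (dsubmx z)], continuous (joint f)}.
Proof.
move=> f_C1.
by apply: within_continuous_coord => i; have [df /gradient_continuous] := f_C1 i.
Qed.

Lemma argmin_addl (T : Type) (D : set T) (c : R) (h : T -> R) :
  argmin D (fun t => c + h t) = argmin D h.
Proof.
by apply/seteqP; split=> t [Dt ht]; split=> // v /ht; rewrite lerD2l.
Qed.

Lemma posdef_unitmx k (M : 'M[R]_k) : posdef M -> M \in unitmx.
Proof.
move=> [_ M0]; rewrite unitmxE unitfE; apply/negP => /det0P[v v0 vM].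
have := M0 v^T; rewrite trmx_eq0 => /(_ v0).
by rewrite trmxK vM mul0mx mxE ltxx.
Qed.

Section Minimizer.
Variables (umin umax : 'cV[R]_m) (f : 'cV[R]_n -> 'cV[R]_m -> 'cV[R]_n)
  (q : 'cV[R]_n -> R) (r : 'cV[R]_m -> R) (lam : 'cV[R]_n -> 'cV[R]_n)
  (u : 'cV[R]_n -> 'cV[R]_m).
Let U := box umin umax.
Hypothesis f_C1 : C1_field U f.
Hypothesis r_smooth : smooth_on U r.
Hypothesis u_argmin : forall x,
  argmin U (hamiltonian q r f x (lam x)) = [set u x].

(* The state cost [q x] does not depend on the control, so that the minimizers are
   those of the rest of the Hamiltonian. *)
Let reduced x v : R := r v + ((lam x)^T *m f x v) 0 0.

Let u_reduced x : argmin U (reduced x) = [set u x].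
Proof.
rewrite -u_argmin -(argmin_addl U (q x) (reduced x)); congr argmin.
by apply/funext => v; rewrite /hamiltonian /reduced addrA.
Qed.

Let uU x : U (u x).
Proof. by have [] : argmin U (reduced x) (u x) by rewrite u_reduced. Qed.

Lemma minimizer_continuous : continuous lam -> continuous u.
Proof.
move=> clam x0; apply: (argmin_continuous (H := reduced) _ u_reduced).
move=> v Uv e e0.
have /within_continuousP/(_ _ Uv) cr : {within U, continuous r}.
  by have [dr /gradient_continuous] := r_smooth 1.
have /within_continuousP cf := joint_continuous f_C1.
have Dv : U (dsubmx (col_mx x0 v)) by rewrite col_mxKd.
pose L := n%:R * (`|f x0 v| + 1 + `|lam x0|).
have L0 : 0 <= L by rewrite mulr_ge0 // !addr_ge0.
pose eta := Num.min 1 (e / 2 / (L + 1)).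
have eta0 : 0 < eta by rewrite lt_min ltr01 !divr_gt0 // ltr_wpDl.
have e2 : 0 < e / 2 by rewrite divr_gt0.
have [d1 d10 h1] := cr _ e2.
have [d2 d20 h2] := cf _ Dv _ eta0.
have [d3 d30 h3] :=
  (cvg_normP (V := 'cV[R]_n) (W := 'cV[R]_n) lam x0 _).1 (clam x0) _ eta0.
exists (Num.min d1 (Num.min d2 d3)); first by rewrite !lt_min d10 d20.
move=> x w Uw; rewrite !lt_min => /and3P[_ xd2 xd3] /and3P[wd1 wd2 _].
have hr := h1 w Uw wd1.
have hl := h3 x xd3.
have hf : `|f x w - f x0 v| <= eta.
  have := h2 (col_mx x w); rewrite /= /joint !col_mxKu !col_mxKd.
  by apply=> //; exact: norm_col_mx_lt.
have -> : reduced x w - reduced x0 v = (r w - r v)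
    + (((lam x - lam x0)^T *m f x w) 0 0 + ((lam x0)^T *m (f x w - f x0 v)) 0 0).
  rewrite /reduced linearB /= mulmxBl mulmxBr !mxE; ring.
apply: le_trans (ler_normD _ _) _; rewrite [e]splitr lerD //.
have fb : `|f x w| <= `|f x0 v| + 1.
  rewrite -[f x w](subrK (f x0 v)) addrC; apply: le_trans (ler_normD _ _) _.
  by rewrite lerD2l (le_trans hf) // ge_min lexx.
apply: le_trans (ler_normD _ _) _; rewrite !norm_mx11.
apply: (@le_trans _ _ (L * eta)).
  have -> : L * eta = n%:R * eta * (`|f x0 v| + 1) + n%:R * `|lam x0| * eta.
    by rewrite /L; ring.
  apply: lerD; apply: le_trans (ler_norm_mulmx _ _) _; rewrite norm_trmx.
    by apply: ler_pM => //; rewrite ?mulr_ge0 // ler_wpM2l.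
  by rewrite ler_wpM2l // mulr_ge0.
apply: (@le_trans _ _ ((L + 1) * (e / 2 / (L + 1)))).
  by apply: ler_pM => //; rewrite ?(ltW eta0) ?lerDl // ge_min lexx orbT.
by rewrite mulrC divfK // gt_eqF // ltr_wpDl.
Qed.

Variables (xf : 'cV[R]_n) (uf : 'cV[R]_m) (P : 'M[R]_n).
Let B := Jac (fun v => f xf v) uf.
Let H := Hess r uf.
Let Rm := 2%:R^-1 *: H.
Hypothesis uf_int : interior U uf.
Hypothesis r_uf : r uf = 0.
Hypothesis r_ge0 : forall v, U v -> 0 <= r v.
Hypothesis Rm_posdef : posdef Rm.
Hypothesis lam_xf : lam xf = 0.
Hypothesis lam_jac : has_jac lam xf (2%:R *: P).
Hypothesis lam_cont : continuous lam.

(** The costate vanishes at [xf], where only [r] is left to minimize. *)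
Lemma minimizer_xf : u xf = uf.
Proof.
have : argmin U (reduced xf) uf; last by rewrite u_reduced => /= ->.
split=> [|v Uv]; first exact: interior_subset.
by rewrite /reduced lam_xf trmx0 !mul0mx !mxE !addr0 r_uf r_ge0.
Qed.

(** Relative gradients are gradients at interior points, hence the second ones are
    second derivatives; [Hess] differentiates first in the direction [j]. *)
Lemma hess_gradient dr (ddr : 'I_m -> 'I_m -> 'cV[R]_m -> R) :
  has_gradient_on U r dr -> (forall j, has_gradient_on U (dr j) (ddr j)) ->
  forall i j, H i j = ddr j i uf.
Proof.
move=> hr hdr i j; rewrite mxE.
have [_ <-] := gradient_is_derive i (hdr j) uf_int.
apply: near_eq_derive.
have := nbhs_interior uf_int; apply: filterS => v vU.
by have [_ ->] := gradient_is_derive j hr vU.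
Qed.

(** Subtracting the expansions from the first-order condition leaves
    [2 R (u x - uf) + 2 B^T P (x - xf)] equal to three errors: that of [r'] at [uf],
    that of [df/du] against a costate of size [O(x - xf)], and that of the costate. *)
Lemma minimizer_has_jac : has_jac u xf (- lqr_gain Rm B P).
Proof.
have ucont : u x @[x --> xf] --> u xf by exact: minimizer_continuous.
have uxf := minimizer_xf.
have ucont_uf : u x @[x --> xf] --> uf by rewrite -uxf.
have [dr hr hdr2] := r_smooth 2.
have /choice[ddr hddr] : forall j, exists d, has_gradient_on U (dr j) d.
  by move=> j; have [d] := hdr2 j; exists d.
pose D := [set z : 'cV[R]_(n + m) | U (dsubmx z)].
have /choice[df hdf] : forall i, exists d,
    has_gradient_on D (fun z => f (usubmx z) (dsubmx z) i 0) d /\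
    forall j, {within D, continuous (d j)}.
  by move=> i; have [d ? ?] := f_C1 i; exists d.
pose Df z : 'M[R]_(n, n + m) := \matrix_(i, j) df i j z.
pose Bx x := rsubmx (Df (col_mx x (u x))).
pose Dr v : 'cV[R]_m := \col_j dr j v.
have HT : H^T = H.
  have [RT _] := Rm_posdef; have -> : H = 2%:R *: Rm.
    by rewrite scalerA mulfV ?scale1r // pnatr_eq0.
  by rewrite linearZ /= RT.
have DrH : has_jac Dr uf H.
  rewrite -HT (_ : H^T = \matrix_(j, i) ddr j i uf).
    exact: gradient_has_jac.
  by apply/matrixP => j i; rewrite !mxE -(hess_gradient hr hddr) mxE.
have fjac x v : interior U v -> has_jac (f x) v (rsubmx (Df (col_mx x v))).
  move=> vU; have [_] := partial_has_jac (joint_has_jac x (fun i => (hdf i).1) vU).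
  by [].
have BE : Bx xf = B.
  by rewrite /Bx uxf; have /has_jacP[_ <-] := fjac xf uf uf_int.
have foc x : interior U (u x) -> Dr (u x) = - ((Bx x)^T *m lam x).
  move=> uxU.
  have rjac : has_jac (fun v => (\col_(i < 1) r v : 'cV[R]_1)) (u x)
      (\matrix_(i, j) dr j (u x)).
    exact: (gradient_has_jac (fun i : 'I_1 => hr) uxU).
  have ljac := has_jac_comp (fjac x _ uxU) (has_jac_mulmx (lam x)^T (f x (u x))).
  have min_u : \forall z \near u x,
      (\col_(i < 1) r (u x) + (mulmx (lam x)^T \o f x) (u x)) 0 0 <=
      (\col_(i < 1) r z + (mulmx (lam x)^T \o f x) z) 0 0.
    have [_ ux_min] : argmin U (reduced x) (u x) by rewrite u_reduced.
    apply: filterS uxU => z Uz; have := ux_min z Uz.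
    by rewrite /reduced !mxE.
  have /matrixP M0 := has_jac_local_min (has_jacD rjac ljac) min_u.
  apply/colP => j; have := M0 0 j; rewrite !mxE => /eqP; rewrite addr_eq0 => /eqP ->.
  by congr (- _); apply: eq_bigr => i _; rewrite !mxE mulrC.
have Bcvg (e : R) : 0 < e -> \forall x \near xf, `|Bx x - B| <= e.
  move=> e0; pose ent i j x := df i (rshift n j) (col_mx x (u x)).
  have ent_cvg i j : \forall x \near xf, `|ent i j x - ent i j xf| <= e.
    have /(cvg_normP (V := 'cV[R]_n))/(_ e e0)[d d0 hd] :=
      joint_cvg ((hdf i).2 (rshift n j)) uU ucont.
    by apply: (near_normP xf _).2; exists d.
  have row_cvg i := @filter_forall _ _ (fun j x => `|ent i j x - ent i j xf| <= e)
    _ _ (ent_cvg i).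
  have : \forall x \near xf, forall i j, `|ent i j x - ent i j xf| <= e.
    exact: (@filter_forall _ _
      (fun i x => forall j, `|ent i j x - ent i j xf| <= e) _ _ (row_cvg _)).
  move=> /(near_normP xf)[d d0 hd]; apply: (near_normP xf _).2; exists d => // x xd.
  rewrite -BE; apply/mx_norm_leP => [|i j]; first exact: ltW.
  by rewrite !mxE; exact: hd.
have Rm_unit := posdef_unitmx Rm_posdef.
have Dr_xf : Dr uf = 0.
  by have := foc xf; rewrite uxf lam_xf mulmx0 oppr0; apply.
pose L := n%:R * `|2%:R *: P| + 1; have L0 : 0 <= L by rewrite addr_ge0 ?mulr_ge0.
pose J := 2%:R^-1 *: invmx Rm.
have JH : J *m H = 1%:M.
  by rewrite /J -scalemxAl scalemxAr mulVmx.
have gainE : lqr_gain Rm B P = J *m (B^T *m (2%:R *: P)).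
  rewrite /lqr_gain /J -scalemxAr -scalemxAr -scalemxAl scalerA mulfV ?pnatr_eq0 //.
  by rewrite scale1r mulmxA.
apply: has_jac_implicit => e e0.
pose c := m%:R * `|J| + 1; have c0 : 0 < c by rewrite ltr_wpDl // mulr_ge0.
pose k := 1 + n%:R * L + n%:R * `|B|.
have k0 : 0 < k by rewrite /k -addrA ltr_pwDl // addr_ge0 // mulr_ge0.
pose e1 := e / c / k; have e10 : 0 < e1 by rewrite !divr_gt0.
near=> x; set y := x - xf; set w := u x - u xf; set l := lam x.
have uxU : interior U (u x).
  by near: x; exact: (ucont_uf _ (nbhs_interior uf_int)).
have h1 : `|Dr (u x) - Dr uf - H *m w| <= e1 * `|w|.
  rewrite /w uxf; near: x; exact: (ucont_uf _ (DrH _ e10)).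
have h2 : `|Bx x - B| <= e1 by near: x; exact: Bcvg.
have h3 : `|l - (2%:R *: P) *m y| <= e1 * `|y|.
  by rewrite /l /y -[lam x]subr0 -lam_xf; near: x; exact: lam_jac.
have h4 : `|l| <= L * `|y|.
  rewrite /l /y -[lam x]subr0 -lam_xf; near: x; exact: has_jac_lip.
have -> : w - - lqr_gain Rm B P *m y = - (J *m ((Dr (u x) - Dr uf - H *m w)
    + (Bx x - B)^T *m l + B^T *m (l - (2%:R *: P) *m y))).
  rewrite mulNmx opprK gainE -[w in LHS]mul1mx -JH -!mulmxA -mulmxDr -mulmxN.
  congr (_ *m _); rewrite (foc _ uxU) Dr_xf subr0 [(_ - B)^T]linearB /=.
  rewrite mulmxBl [B^T *m (_ - _)]mulmxBr.
  by apply/colP => i; rewrite !mxE; ring.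
rewrite normrN; apply: le_trans (ler_norm_mulmx _ _) _.
apply: (@le_trans _ _ (c * (e1 * (k * (`|w| + `|y|))))).
  apply: ler_pM => //; rewrite ?mulr_ge0 ?lerDl //.
  have b2 : `|(Bx x - B)^T *m l| <= n%:R * e1 * (L * `|y|).
    apply: le_trans (ler_norm_mulmx _ _) _; rewrite norm_trmx.
    by apply: ler_pM => //; rewrite ?mulr_ge0 // ler_wpM2l.
  have b3 : `|B^T *m (l - (2%:R *: P) *m y)| <= n%:R * `|B| * (e1 * `|y|).
    apply: le_trans (ler_norm_mulmx _ _) _; rewrite norm_trmx.
    by rewrite ler_wpM2l // mulr_ge0.
  apply: (@le_trans _ _ (e1 * `|w| + n%:R * e1 * (L * `|y|)
      + n%:R * `|B| * (e1 * `|y|))).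
    apply: le_trans (ler_normD _ _) _; apply: lerD => //.
    by apply: le_trans (ler_normD _ _) _; apply: lerD.
  have -> : e1 * `|w| + n%:R * e1 * (L * `|y|) + n%:R * `|B| * (e1 * `|y|) =
      e1 * (`|w| + (n%:R * L + n%:R * `|B|) * `|y|) by ring.
  have -> : k * (`|w| + `|y|) = `|w| + (n%:R * L + n%:R * `|B|) * `|y|
      + ((n%:R * L + n%:R * `|B|) * `|w| + `|y|) by rewrite /k; ring.
  rewrite ler_pM2l // lerDl.
  by rewrite addr_ge0 // mulr_ge0 // addr_ge0 // mulr_ge0.
rewrite (_ : c * _ = e * (`|w| + `|y|)) // /e1; field.
by rewrite !gt_eqF.
Unshelve. all: by end_near. Qed.

End Minimizer.
End Feedback.

(** * Saturation functions *)

Section Saturation.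
Context {R : realType}.

Definition smooth_sat1 (lo hi c t : R) : R :=
  lo + (hi - lo) / (1 + (hi - c) / (c - lo) *
    expR (- ((hi - lo) / ((hi - c) * (c - lo))) * (t - c))).

Section OneDim.
Variables lo hi c : R.
Hypothesis loc : lo < c.
Hypothesis chi : c < hi.

Let c1 := (hi - c) / (c - lo).
Let c2 := (hi - lo) / ((hi - c) * (c - lo)).
Let c1_gt0 : 0 < c1. Proof. by rewrite divr_gt0 // subr_gt0. Qed.
Let den t := 1 + c1 * expR (- c2 * (t - c)).
Let den_gt1 t : 1 < den t. Proof. by rewrite ltrDl mulr_gt0 // expR_gt0. Qed.

Lemma smooth_sat1_itv t : lo <= smooth_sat1 lo hi c t <= hi.
Proof.
have lh : 0 <= hi - lo by rewrite subr_ge0 ltW // (lt_trans loc).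
have d0 : 0 < den t by exact: lt_trans (den_gt1 t).
rewrite /smooth_sat1 -/c1 -/c2 -/(den t) lerDl divr_ge0 ?(ltW d0) //=.
rewrite -lerBrDl ler_pdivrMr // ler_peMr // ltW //; exact: den_gt1.
Qed.

Lemma smooth_sat1_center : smooth_sat1 lo hi c c = c.
Proof.
rewrite /smooth_sat1 subrr mulr0 expR0; field.
by apply/andP; split; rewrite gt_eqF //; move: loc chi; lra.
Qed.

Lemma is_derive_smooth_sat1 (t : R) : is_derive t 1 (smooth_sat1 lo hi c)
  ((hi - lo) * (c1 * c2 * expR (- c2 * (t - c))) / den t ^+ 2).
Proof.
have d0 : den t != 0 by rewrite gt_eqF // (lt_trans ltr01).
have dlin : is_derive t 1 (fun s => - c2 * (s - c)) (- c2).
  have dsub : is_derive t 1 (fun s : R => s - c) 1.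
    have /is_derive_eq := is_deriveB (is_derive_id t 1) (is_derive_cst c t (1 : R)).
    by apply; rewrite subr0.
  have /is_derive_eq := is_deriveZ (- c2) dsub.
  by apply; rewrite [_ *: _]mulr1.
have dexp : is_derive t 1 (fun s => expR (- c2 * (s - c)))
    (expR (- c2 * (t - c)) * - c2) by exact: (@is_derive1_comp R expR).
have dden : is_derive t 1 den (c1 * (expR (- c2 * (t - c)) * - c2)).
  have /is_derive_eq := is_deriveD (is_derive_cst (1 : R) t (1 : R)) (is_deriveZ c1 dexp).
  by apply; rewrite add0r.
have dinv : is_derive t 1 (fun s => (den s)^-1)
    (- den t ^- 2 * (c1 * (expR (- c2 * (t - c)) * - c2))).
  by have [dd <-] := dden; split; [exact: derivableV|rewrite deriveV].
have /is_derive_eq := is_deriveD (is_derive_cst lo t (1 : R)) (is_deriveZ (hi - lo) dinv).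
apply; rewrite /GRing.scale /= add0r; ring.
Qed.

(** The constants of the smooth saturation are chosen for this: at the centre the
    denominator is [(hi - lo) / (c - lo)], and everything cancels. *)
Lemma is_derive_smooth_sat1_center : is_derive c 1 (smooth_sat1 lo hi c) 1.
Proof.
apply: is_derive_eq (is_derive_smooth_sat1 c) _.
rewrite /den /c1 /c2 subrr mulr0 expR0; field.
by apply/and3P; split; rewrite gt_eqF //; move: loc chi; lra.
Qed.

End OneDim.

Variables (m : nat) (umin umax uf : 'cV[R]_m).
Hypothesis uf_int : interior (box umin umax) uf.

Lemma interior_box i : umin i 0 < uf i 0 < umax i 0.
Proof.
have /near_normP[d d0 hd] := uf_int.
have step s : `|s| < d -> umin i 0 <= uf i 0 + s <= umax i 0.
  move=> sd; have := hd (uf + s *: delta_mx i 0).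
  rewrite addrAC subrr add0r normrZ norm_delta_mx mulr1 => /(_ sd i).
  by rewrite !mxE !eqxx mulr1.
have d2 : `|d / 2| < d.
  by rewrite ger0_norm ?divr_ge0 ?(ltW d0) // ltr_pdivrMr // ltr_pMr // ltr1n.
have := step (d / 2) d2; have := step (- (d / 2)); rewrite normrN => /(_ d2).
by move=> /andP[h1 _] /andP[_ h2]; apply/andP; split; lra.
Qed.

Lemma smooth_satE u :
  smooth_sat umin umax uf u =
  \col_i smooth_sat1 (umin i 0) (umax i 0) (uf i 0) (u i 0).
Proof. by []. Qed.

Lemma smooth_sat_box u : box umin umax (smooth_sat umin umax uf u).
Proof.
move=> i; rewrite smooth_satE mxE; have /andP[h1 h2] := interior_box i.
exact: smooth_sat1_itv.
Qed.

Lemma smooth_sat_center : smooth_sat umin umax uf uf = uf.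
Proof.
apply/colP => i; rewrite smooth_satE mxE; have /andP[h1 h2] := interior_box i.
exact: smooth_sat1_center.
Qed.

Lemma smooth_sat_has_jac : has_jac (smooth_sat umin umax uf) uf 1%:M.
Proof.
have := @has_jac_map R m (fun i => smooth_sat1 (umin i 0) (umax i 0) (uf i 0))
  (fun=> 1) uf.
rewrite (_ : diag_mx _ = 1%:M); last first.
  by apply/matrixP => i j; rewrite !mxE.
apply=> i; have /andP[h1 h2] := interior_box i.
exact: is_derive_smooth_sat1_center.
Qed.

Lemma smooth_sat_continuous : continuous (smooth_sat umin umax uf).
Proof.
move=> u; have := @has_jac_map R m (fun i => smooth_sat1 (umin i 0) (umax i 0) (uf i 0)).
move=> /(_ _ u (fun i => is_derive_smooth_sat1 _ _ _)) h.
apply: has_jac_cvg; apply: h => i; by have /andP[] := interior_box i.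
Qed.

Lemma sat_lip u v : `|sat umin umax u - sat umin umax v| <= `|u - v|.
Proof.
apply/mx_norm_leP => // i j; rewrite ord1 !mxE.
have := ler_mx_coord (u - v) i 0; rewrite !mxE; apply: le_trans.
have /andP[h1 h2] := interior_box i; have h := lt_trans h1 h2.
have := ler_norm (u i 0 - v i 0); have := ler_norm (v i 0 - u i 0).
rewrite [`|v i 0 - _|]distrC ler_norml; set d := `|_ - _|.
case: (ltP (u i 0) (umin i 0)); case: (leP (u i 0) (umax i 0));
case: (ltP (v i 0) (umin i 0)); case: (leP (v i 0) (umax i 0)) => *;
apply/andP; split; lra.
Qed.

Lemma sat_continuous : continuous (sat umin umax).
Proof.
move=> u; apply: (cvg_normP (V := 'cV[R]_m) (W := 'cV[R]_m) _ u _).2 => e e0.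
by exists e => // v /ltW ve; apply: le_trans ve; exact: sat_lip.
Qed.

Lemma sat_id u : box umin umax u -> sat umin umax u = u.
Proof.
move=> uU; apply/colP => i; rewrite mxE; have /andP[h1 h2] := uU i.
by rewrite ltNge h1 h2.
Qed.

End Saturation.

(** * Saturated policies *)

Section SaturatedPolicy.
Context {R : realType} {n m : nat}.
Variables (umin umax uf : 'cV[R]_m) (K : 'M[R]_(m, n)) (xf : 'cV[R]_n)
  (w : 'cV[R]_n -> 'cV[R]_m).
Hypothesis uf_int : interior (box umin umax) uf.
Hypothesis w_jac : has_jac w xf 0.
Hypothesis w_xf : w xf = 0.
Hypothesis w_cont : continuous w.

Let v x := sat umin umax (u_lqr K xf uf x) + w x.
Let pol x := smooth_sat umin umax uf (v x).

Let u_lqr_jac a : has_jac (u_lqr K xf uf) a (- K).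
Proof.
by apply: eq_has_jac (has_jac_affine (- K) xf uf a) => x; rewrite /u_lqr addrC mulNmx.
Qed.

Let u_lqr_xf : u_lqr K xf uf xf = uf.
Proof. by rewrite /u_lqr subrr mulmx0 subr0. Qed.

Let v_xf : v xf = uf.
Proof. by rewrite /v u_lqr_xf w_xf addr0 sat_id //; exact: interior_subset. Qed.

Lemma saturated_policy_xf : pol xf = uf.
Proof. by rewrite /pol v_xf smooth_sat_center. Qed.

Lemma saturated_policy_box x : box umin umax (pol x).
Proof. exact: smooth_sat_box. Qed.

Lemma saturated_policy_continuous : continuous pol.
Proof.
have lqr_cont : continuous (u_lqr K xf uf) by move=> x; exact: has_jac_cvg (u_lqr_jac x).
have sat_lqr x : sat umin umax (u_lqr K xf uf z) @[z --> x] --> sat umin umax (u_lqr K xf uf x).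
  exact: (continuous_comp (lqr_cont x) (@sat_continuous _ _ _ _ _ uf_int _)).
have v_cont x : v z @[z --> x] --> v x.
  exact: (continuous_atD (V := 'cV[R]_n) (W := 'cV[R]_m) (sat_lqr x) (@w_cont x)).
by move=> x; exact: (continuous_comp (v_cont x) (@smooth_sat_continuous _ _ _ _ _ uf_int _)).
Qed.

Lemma saturated_policy_has_jac : has_jac pol xf (- K).
Proof.
have sat_lqr : has_jac (fun x => sat umin umax (u_lqr K xf uf x)) xf (- K).
  apply: eq_near_has_jac (u_lqr_jac xf).
  have lqr_cvg : u_lqr K xf uf x @[x --> xf] --> uf.
    have : u_lqr K xf uf x @[x --> xf] --> u_lqr K xf uf xf.
      exact: has_jac_cvg (u_lqr_jac xf).
    by rewrite u_lqr_xf.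
  by near=> x; rewrite sat_id //; near: x; exact: (lqr_cvg _ uf_int).
have v_jac := has_jacD sat_lqr w_jac.
have sat_jac : has_jac (smooth_sat umin umax uf) (v xf) 1%:M.
  by rewrite v_xf; exact: smooth_sat_has_jac.
by have := has_jac_comp v_jac sat_jac; rewrite mul1mx addr0.
Unshelve. all: by end_near. Qed.

End SaturatedPolicy.

(** * A strict Lyapunov function for the LQR closed loop *)

Section LQR.
Context {R : realType} {n m : nat}.
Variables (A : 'M[R]_n) (B : 'M[R]_(n, m)) (Q sqrtQ P : 'M[R]_n) (Rm : 'M[R]_m).
Let K := lqr_gain Rm B P.
Hypothesis Rm_posdef : posdef Rm.
Hypothesis sqrtQ_def : is_sqrtmx Q sqrtQ.
Hypothesis AQ_observable : observable A sqrtQ.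
Hypothesis P_posdef : posdef P.
Hypothesis riccati :
  Q + A^T *m P + P *m A - P *m B *m invmx Rm *m B^T *m P = 0.

Let S := Q + K^T *m Rm *m K.
Let Acl := A - B *m K.

(** The Riccati equation, completed to a square: [R K = B^T P] turns
    [P B R^-1 B^T P] into [K^T R K]. *)
Lemma lqr_lie : lie Acl P = - S.
Proof.
have [RT _] := Rm_posdef; have [PT _] := P_posdef.
have Runit := posdef_unitmx Rm_posdef.
have RK : Rm *m K = B^T *m P by rewrite /K /lqr_gain !mulmxA mulmxV // mul1mx.
have KTR : K^T *m Rm = P *m B.
  by rewrite -[Rm in LHS]RT -trmx_mul RK trmx_mul trmxK PT.
have PBK : P *m B *m invmx Rm *m B^T *m P = P *m B *m K.
  by rewrite /K /lqr_gain !mulmxA.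
have := riccati; rewrite PBK => ric.
have KBP : K^T *m B^T *m P = P *m B *m K.
  by rewrite -mulmxA -RK mulmxA KTR.
rewrite /lie /Acl /S linearB /= trmx_mul mulmxBl mulmxBr KTR KBP.
rewrite !mulmxA; apply/eqP; rewrite -subr_eq0 opprK -[X in _ == X]riccati.
move: (P *m B *m _ *m _ *m _) (A^T *m P) (P *m A) => X Y Z; apply/eqP.
by apply/matrixP => i j; rewrite !mxE; ring.
Qed.

Lemma dotmx_ge0 k (v : 'cV[R]_k) : 0 <= (v^T *m v) 0 0.
Proof. by rewrite mxE sumr_ge0 // => i _; rewrite mxE -expr2 sqr_ge0. Qed.

Lemma dotmx_eq0 k (v : 'cV[R]_k) : (v^T *m v) 0 0 = 0 -> v = 0.
Proof.
rewrite mxE => /eqP; rewrite psumr_eq0 => [/allP h|i _]; last first.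
  by rewrite mxE -expr2 sqr_ge0.
apply/colP => i; have := h i; rewrite mem_index_enum => /(_ isT).
by rewrite !mxE mulf_eq0 orbb => /eqP.
Qed.

Lemma lqr_cost_form (x : 'cV[R]_n) :
  qform S x = ((sqrtQ *m x)^T *m (sqrtQ *m x)) 0 0 + qform Rm (K *m x).
Proof.
have [[QT _] QE] := sqrtQ_def.
by rewrite qform_mxD -QE /qform /bform !trmx_mul QT !mulmxA.
Qed.

Lemma qform_Rm_ge0 (v : 'cV[R]_m) : 0 <= qform Rm v.
Proof.
have [_ R0] := Rm_posdef; have [->|v0] := eqVneq v 0; last exact/ltW/R0.
by rewrite /qform /bform mulmx0 mxE.
Qed.

Lemma lqr_cost_ge0 (x : 'cV[R]_n) : 0 <= qform S x.
Proof. by rewrite lqr_cost_form addr_ge0 ?dotmx_ge0 ?qform_Rm_ge0. Qed.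

Lemma lqr_cost_eq0 (x : 'cV[R]_n) : qform S x = 0 -> sqrtQ *m x = 0 /\ K *m x = 0.
Proof.
rewrite lqr_cost_form => /eqP; rewrite paddr_eq0 ?dotmx_ge0 ?qform_Rm_ge0 //.
move=> /andP[/eqP/dotmx_eq0 -> /eqP Kx]; split=> //.
have [_ R0] := Rm_posdef; apply/eqP/negPn/negP => /R0.
by rewrite -/(bform Rm _ _) -/(qform Rm _) Kx ltxx.
Qed.

(** An unobservable state of [(Acl, S)] has [K Acl^j x = 0] for all [j < n], so that
    the feedback never acts on it: [Acl^j x = A^j x], and [x] is unobservable for
    [(A, sqrtQ)]. *)
Lemma lqr_observable (x : 'cV[R]_n) :
  (forall j, (j < n)%N -> S *m Acl ^+ j *m x = 0) -> x = 0.
Proof.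
move=> Sx.
have ker j : (j < n)%N ->
    sqrtQ *m (Acl ^+ j *m x) = 0 /\ K *m (Acl ^+ j *m x) = 0.
  move=> jn; apply: lqr_cost_eq0.
  have Sv : S *m (Acl ^+ j *m x) = 0 by rewrite mulmxA Sx.
  by rewrite /qform /bform -[_ *m S *m _]mulmxA Sv mulmx0 mxE.
have pow j : (j <= n)%N -> Acl ^+ j *m x = A ^+ j *m x.
  elim: j => [|j IHj] jn; first by rewrite !expr0.
  have [_ Kx] := ker j jn.
  rewrite !exprS -!mulmxE -!mulmxA -(IHj (ltnW jn)) {1}/Acl mulmxBl -[B *m K *m _]mulmxA.
  by rewrite Kx mulmx0 subr0.
have obs0 : (\mxcol_(j < n) (sqrtQ *m A ^+ j)) *m x = 0.
  rewrite mxcol_mul -(@mxcol0 _ _ (fun=> n)); apply: eq_mxcol => j.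
  by rewrite -mulmxA -(pow j (ltnW (ltn_ord j))); have [] := ker j (ltn_ord j).
have /row_fullP[V VM] : row_full (\mxcol_(j < n) (sqrtQ *m A ^+ j)) by exact/eqP.
by rewrite -[x]mul1mx -VM -mulmxA obs0 mulmx0.
Qed.

Lemma lqr_lyapunov : exists W c, [/\ 0 < c, forall x, c * `|x| ^+ 2 <= qform W x &
    forall x, qform (lie Acl W) x <= - (c * `|x| ^+ 2)].
Proof.
have [PT P0] := P_posdef; have [[QT _] QE] := sqrtQ_def; have [RT _] := Rm_posdef.
apply: (@strict_lyapunov _ _ Acl S P).
- by move=> x /P0.
- by move=> x; rewrite lqr_lie qform_mxN.
- rewrite /S -QE linearD /= [(sqrtQ *m _)^T]trmx_mul QT.
  by rewrite [(K^T *m Rm *m K)^T]trmx_mul [(K^T *m Rm)^T]trmx_mul trmxK RT mulmxA.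
- exact: lqr_cost_ge0.
- move=> x /lqr_cost_eq0[Qx Kx].
  by rewrite /S mulmxDl -QE -(mulmxA sqrtQ) Qx -(mulmxA _ K) Kx !mulmx0 addr0.
- exact: lqr_observable.
Qed.

End LQR.

(** * Closed loop of an LQR-like policy *)

Section ClosedLoop.
Context {R : realType} {n m : nat}.

Lemma closed_loop_stability (U : set 'cV[R]_m)
    (f : 'cV[R]_n -> 'cV[R]_m -> 'cV[R]_n) (xf : 'cV[R]_n) (uf : 'cV[R]_m)
    (K : 'M[R]_(m, n)) (pol : 'cV[R]_n -> 'cV[R]_m) (W : 'M[R]_n) (c : R) :
  let A := Jac (fun x => f x uf) xf in
  let B := Jac (fun u => f xf u) uf in
  C1_field U f -> interior U uf -> f xf uf = 0 ->
  (forall x, U (pol x)) -> continuous pol -> pol xf = uf -> has_jac pol xf (- K) ->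
  0 < c -> (forall x, c * `|x| ^+ 2 <= qform W x) ->
  (forall x, qform (lie (A - B *m K) W) x <= - (c * `|x| ^+ 2)) ->
  loc_asymp_stable_equilibrium (fun x => f x (pol x)) xf.
Proof.
move=> A B f_C1 uf_int f_eq polU pol_cont pol_xf pol_jac c0 Wc lieW.
pose g x := f x (pol x).
have gE x : g x = joint f (col_mx x (pol x)) by rewrite /joint col_mxKu col_mxKd.
apply: (linearized_stability (A := A - B *m K) _ _ _ c0 Wc lieW).
- pose D := [set z : 'cV[R]_(n + m) | U (dsubmx z)].
  have /choice[df hdf] : forall i, exists d,
      has_gradient_on D (fun z => f (usubmx z) (dsubmx z) i 0) d.
    by move=> i; have [d] := f_C1 i; exists d.
  have jf := joint_has_jac xf hdf uf_int.
  have [/has_jacP[_ AE] /has_jacP[_ BE]] := partial_has_jac jf.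
  have {}jf : has_jac (joint f) (col_mx xf (pol xf)) (row_mx A B).
    by rewrite pol_xf /A AE /B BE hsubmxK.
  have := has_jac_comp (has_jac_col_mx (has_jac_id xf) pol_jac) jf.
  rewrite mul_row_col mulmx1 mulmxN.
  by apply: eq_has_jac => x; rewrite /= -gE.
- by rewrite pol_xf.
- move=> x; have := joint_cvg (joint_continuous f_C1) polU (@pol_cont x).
  rewrite -gE; rewrite (_ : (fun x => _) = g) //; apply/funext => z; by rewrite -gE.
Qed.

End ClosedLoop.

(** * Costate predictors *)

Section Costate.
Context {R : realType} {n : nat}.

Lemma lambda_jac_xf (P : 'M[R]_n) xf N : lambda_jac P xf N xf = 0.
Proof. by rewrite /lambda_jac subrr mulmx0 add0r subrr. Qed.

Lemma lambda_mat_xf (P : 'M[R]_n) xf N : lambda_mat P xf N xf = 0.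
Proof. by rewrite /lambda_mat subrr mulmx0. Qed.

Lemma lambda_jac_has_jac (P : 'M[R]_n) xf N : feedforward N ->
  has_jac (lambda_jac P xf N) xf (2%:R *: P).
Proof.
move=> ffN; rewrite -[2%:R *: P in X in has_jac _ _ X](subrK (Jac N xf)).
apply: eq_has_jac (has_jacD (has_jac_affine (2%:R *: P - Jac N xf) xf (- N xf) xf)
  (feedforward_jac xf ffN)) => x.
by rewrite /lambda_jac addrAC.
Qed.

Lemma lambda_jac_continuous (P : 'M[R]_n) xf N : feedforward N ->
  continuous (lambda_jac P xf N).
Proof.
move=> ffN a; have [M NM] := feedforward_has_jac ffN a.
apply: has_jac_cvg.
apply: eq_has_jac (has_jacD (has_jac_affine (2%:R *: P - Jac N xf) xf (- N xf) a) NM) => x.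
by rewrite /lambda_jac addrAC.
Qed.

Lemma lambda_mat_has_jac (P : 'M[R]_n) xf N : continuous N ->
  has_jac (lambda_mat P xf N) xf (2%:R *: P).
Proof.
move=> cN; rewrite -[2%:R *: P in X in has_jac _ _ X]addr0.
apply: eq_has_jac (has_jacD (has_jac_affine (2%:R *: P) xf 0 xf)
  (has_jac_small_mul (@cN xf))) => x.
by rewrite /lambda_mat addr0 -mulmxDl addrA.
Qed.

Lemma small_mul_continuous k (N : 'cV[R]_n -> 'M[R]_(k, n)) xf : continuous N ->
  continuous (fun x => (N x - N xf) *m (x - xf)).
Proof.
move=> cN; apply: (continuous_mulmx_fun (V := 'cV[R]_n)) => a.
  exact: (continuous_at_sub (V := 'cV[R]_n) (W := 'M[R]_(k, n)) (c := N xf) (@cN a)).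
apply: has_jac_cvg; apply: eq_has_jac (has_jac_affine 1%:M xf 0 a) => x.
by rewrite mul1mx addr0.
Qed.

Lemma lambda_mat_continuous (P : 'M[R]_n) xf N : continuous N ->
  continuous (lambda_mat P xf N).
Proof.
move=> cN; have -> : lambda_mat P xf N =
    fun x => ((2%:R *: P) *m (x - xf) + 0) + (N x - N xf) *m (x - xf).
  by apply/funext => x; rewrite /lambda_mat addr0 -mulmxDl addrA.
move=> a; have aff : (fun x => (2%:R *: P) *m (x - xf) + 0) x @[x --> a] -->
    ((2%:R *: P) *m (a - xf) + 0).
  exact: has_jac_cvg (has_jac_affine (2%:R *: P) xf 0 a).
exact: (continuous_atD (V := 'cV[R]_n) (W := 'cV[R]_n) aff
  (@small_mul_continuous _ _ xf cN a)).
Qed.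

End Costate.

(** * The four policies *)

(** The properties shared by the four policies, and sufficient for stability. *)
Definition lqr_policy (R : realType) n m (umin umax : 'cV[R]_m) (K : 'M[R]_(m, n))
    (xf : 'cV[R]_n) (uf : 'cV[R]_m) (pol : 'cV[R]_n -> 'cV[R]_m) : Prop :=
  [/\ forall x, box umin umax (pol x), continuous pol, pol xf = uf &
    has_jac pol xf (- K)].

Lemma saturated_lqr_policy (R : realType) n m (umin umax : 'cV[R]_m)
    (K : 'M[R]_(m, n)) (xf : 'cV[R]_n) (uf : 'cV[R]_m) w pol :
  interior (box umin umax) uf -> has_jac w xf 0 -> w xf = 0 -> continuous w ->
  (forall x, pol x =
     smooth_sat umin umax uf (sat umin umax (u_lqr K xf uf x) + w x)) ->
  lqr_policy umin umax K xf uf pol.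
Proof.
move=> uf_int w_jac w_xf w_cont polE.
have -> : pol = fun x =>
    smooth_sat umin umax uf (sat umin umax (u_lqr K xf uf x) + w x).
  exact/funext.
split.
- by move=> x; exact: saturated_policy_box.
- exact: saturated_policy_continuous.
- exact: saturated_policy_xf.
- exact: saturated_policy_has_jac.
Qed.

Theorem proposition1 (R : realType) (n m : nat)
    (umin umax : 'cV[R]_m)
    (f : 'cV[R]_n -> 'cV[R]_m -> 'cV[R]_n)
    (xf : 'cV[R]_n) (uf : 'cV[R]_m)
    (q : 'cV[R]_n -> R) (r : 'cV[R]_m -> R)
    (x0 : 'cV[R]_n)
    (sqrtQ P : 'M[R]_n)
    (uhat : 'cV[R]_n -> 'cV[R]_m) :
  let U := box umin umax in
  let A := Jac (fun x => f x uf) xf in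
  let B := Jac (fun u => f xf u) uf in
  let Q := 2%:R^-1 *: Hess q xf in
  let Rm := 2%:R^-1 *: Hess r uf in
  let K := lqr_gain Rm B P in
  forall
    (f_C1 : C1_field U f)
    (f_eq : f xf uf = 0)
    (uf_int : interior U uf)
    (q_smooth : smooth_on setT q)
    (r_smooth : smooth_on U r)
    (q_ge0 : forall x, 0 <= q x)
    (q_xf : q xf = 0)
    (r_uf : r uf = 0)
    (r_ge0 : forall u, U u -> 0 <= r u)
    (r_gt0 : forall u, U u -> u != uf -> 0 < r u)
    (ocp_well_posed : well_posed U f q r x0)
    (Rm_posdef : posdef Rm)
    (AB_controllable : controllable A B)
    (sqrtQ_def : is_sqrtmx Q sqrtQ)
    (AQ_observable : observable A sqrtQ)
    (P_posdef : posdef P)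
    (riccati :
      Q + A^T *m P + P *m A - P *m B *m invmx Rm *m B^T *m P = 0)
    (uhat_form :
      [\/ exists p (N : 'cV[R]_n -> 'cV[R]_p -> 'cV[R]_n) theta ustar,
            [/\ network N,
                forall x lam,
                  argmin U (hamiltonian q r f x lam) = [set ustar x lam] &
                forall x,
                  uhat x = ustar x (lambda_jac P xf (N ^~ theta) x)],
          exists p (N : 'cV[R]_n -> 'cV[R]_p -> 'cV[R]_(n * n)) theta ustar,
            [/\ network N,
                forall x lam,
                  argmin U (hamiltonian q r f x lam) = [set ustar x lam] &
                forall x,
                  uhat x = ustar x
                    (lambda_mat P xf (fun z => reshape_mx (N z theta)) x)],
          exists p (N : 'cV[R]_n -> 'cV[R]_p -> 'cV[R]_m) theta,
            network N /\
            forall x,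
              uhat x = u_jac umin umax K xf uf (N ^~ theta) x |
          exists p (N : 'cV[R]_n -> 'cV[R]_p -> 'cV[R]_(m * n)) theta,
            network N /\
            forall x,
              uhat x = u_mat umin umax K xf uf
                (fun z => reshape_mx (N z theta)) x]),
  [/\ differentiable uhat xf,
      Jac uhat xf = - K &
      loc_asymp_stable_equilibrium (fun x => f x (uhat x)) xf].
Proof.
move=> U A B Q Rm K f_C1 f_eq uf_int _ r_smooth _ _ r_uf r_ge0 _ _ Rm_posdef _
  sqrtQ_def AQ_observable P_posdef riccati uhat_form.
have from_costate (lam : 'cV[R]_n -> 'cV[R]_n) (ustar : 'cV[R]_n -> 'cV[R]_n -> 'cV[R]_m) :
    lam xf = 0 -> has_jac lam xf (2%:R *: P) -> continuous lam ->
    (forall x l, argmin U (hamiltonian q r f x l) = [set ustar x l]) ->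
    (forall x, uhat x = ustar x (lam x)) -> lqr_policy umin umax K xf uf uhat.
  move=> lam_xf lam_jac lam_cont ustarP uhatE.
  have uhat_argmin x : argmin U (hamiltonian q r f x (lam x)) = [set uhat x].
    by rewrite uhatE ustarP.
  split.
  - move=> x; have [] : argmin U (hamiltonian q r f x (lam x)) (uhat x).
      by rewrite uhat_argmin.
    by [].
  - exact: (minimizer_continuous f_C1 r_smooth uhat_argmin).
  - exact: (minimizer_xf uhat_argmin uf_int).
  - exact: (minimizer_has_jac f_C1 r_smooth uhat_argmin).
have [uhatU uhat_cont uhat_xf uhat_jac] : lqr_policy umin umax K xf uf uhat.
  case: uhat_form => -[p [N [theta]]].
  - move=> [ustar [/(_ theta) ffN ustarP uhatE]].
    apply: (from_costate _ _ _ _ _ ustarP uhatE).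
    + exact: lambda_jac_xf.
    + exact: lambda_jac_has_jac.
    + exact: lambda_jac_continuous.
  - move=> [ustar [/(_ theta) ffN ustarP uhatE]].
    have cN := reshape_continuous (feedforward_continuous ffN).
    apply: (from_costate _ _ _ _ _ ustarP uhatE).
    + exact: lambda_mat_xf.
    + exact: (lambda_mat_has_jac P xf cN).
    + by apply: lambda_mat_continuous.
  - move=> [/(_ theta) ffN uhatE].
    pose w x := - Jac (N ^~ theta) xf *m (x - xf) + - N xf theta + N x theta.
    apply: (saturated_lqr_policy (w := w)) => //.
    + rewrite -(addNr (Jac (N ^~ theta) xf)).
      exact: has_jacD (has_jac_affine _ _ _ _) (feedforward_jac xf ffN).
    + by rewrite /w subrr mulmx0 add0r addNr.
    + move=> x; have [M NM] := feedforward_has_jac ffN x.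
      exact: has_jac_cvg (has_jacD (has_jac_affine _ _ _ _) NM).
    + by move=> x; rewrite uhatE /u_jac /w mulNmx [in RHS]addrAC !addrA.
  - move=> [/(_ theta) ffN uhatE].
    have cN := reshape_continuous (feedforward_continuous ffN).
    apply: (saturated_lqr_policy _ (has_jac_small_mul (@cN xf)) _ _ uhatE) => //.
    + by rewrite subrr mul0mx.
    + by apply: small_mul_continuous.
have /has_jacP[uhat_diff uhat_Jac] := uhat_jac.
have [W [c [c0 Wc lieW]]] :=
  lqr_lyapunov Rm_posdef sqrtQ_def AQ_observable P_posdef riccati.
split=> //.
exact: (closed_loop_stability f_C1 uf_int f_eq uhatU uhat_cont uhat_xf uhat_jac
  c0 Wc lieW).
Qed.
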